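(* Under the explicit-state encoding, STOCHASTIC-MINIMUM-PRESERVATION and STOCHASTIC-ANCHOR-PRESERVATION are both decidable in polynomial time.
   Context: A stochastic decision problem is a tuple $\mathcal{D}_S=(A,X_1,\ldots,X_n,U,P)$ with $A$ a finite set of actions, $X_i$ finite sets, $S=X_1\times\cdots\times X_n$, $U:A\times S\to\mathbb{Q}$, $P$ a probability distribution on $S$. $s_I$ is the restriction of $s$ to coordinates in $I$. $\mathrm{Opt}(s)=\arg\max_{a\in A}U(a,s)$. For a value $\alpha$ of the $I$-coordinates, $\mathrm{Opt}^{\mathrm{stoch}}_I(\alpha)=\arg\max_{a\in A}\sum_{s:\,s_I=\alpha}P(s)U(a,s)$ (for positive-probability fibers this is $\arg\max_a\mathbb{E}[U(a,S)\mid S_I=\alpha]$). $I$ is stochastically sufficient if $\mathrm{Opt}^{\mathrm{stoch}}_I(s_I)=\mathrm{Opt}(s)$ for all $s\in S$. STOCHASTIC-MINIMUM-PRESERVATION: given $\mathcal{D}_S$ and $k\in\mathbb{N}$, does there exist a stochastically sufficient $I$ with $|I|\le k$? STOCHASTIC-ANCHOR-PRESERVATION: given $\mathcal{D}_S$ and $I$, does there exist $s_0\in S$ such that $\mathrm{Opt}^{\mathrm{stoch}}_I(s_I)=\mathrm{Opt}(s)$ for every $s$ with $s_I=(s_0)_I$? In the explicit-state encoding the input lists all states of $S$, the full table of $U(a,s)$, and all probabilities $P(s)$, so input size is polynomial in $|S|\cdot|A|$. *)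

(* Defs.v *)
From HB Require Import structures.
From mathcomp Require Import all_boot all_order all_algebra.

Set Implicit Arguments.
Unset Strict Implicit.
Unset Printing Implicit Defensive.

Import Order.TTheory GRing.Theory Num.Theory.
Local Open Scope ring_scope.

(* Deterministic multi-tape Turing machines.  Cells hold None (blank), an     *)
(* input symbol, or a symbol of the machine's auxiliary alphabet.             *)

Definition cell (Sigma Gamma : Type) : Type := option (Sigma + Gamma).

Inductive move := MoveL | Stay | MoveR.

(* [verdict q] is [Some b] exactly when [q] is a halting state, with [b] the  *)
(* answer; there are [work_tapes] tapes besides the input tape, tape 0, which *)
(* may also be overwritten.                                                   *)
Record machine (Sigma : finType) := Machine {
  work_tapes : nat;
  aux_symbol : finType;
  control : finType;
  start : control;
  verdict : control -> option bool;
  transition :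
    control -> {ffun 'I_work_tapes.+1 -> cell Sigma aux_symbol} ->
    control * {ffun 'I_work_tapes.+1 -> cell Sigma aux_symbol * move}
}.

(* A two-way infinite tape: cells left of the head, nearest first, and cells  *)
(* from the scanned one rightwards; everything beyond both lists is blank.    *)
Definition tape (C : Type) : Type := (seq (option C) * seq (option C))%type.

Definition tape_read C (t : tape C) : option C := head None t.2.

Definition tape_write C (c : option C) (t : tape C) : tape C :=
  (t.1, c :: behead t.2).

Definition tape_move C (m : move) (t : tape C) : tape C :=
  match m with
  | MoveL => (behead t.1, head None t.1 :: t.2)
  | Stay => t
  | MoveR => (head None t.2 :: t.1, behead t.2)
  end.

Section Execution.
Variables (Sigma : finType) (M : machine Sigma).

Definition config : Type :=
  (control M *
   {ffun 'I_(work_tapes M).+1 -> tape (Sigma + aux_symbol M)})%type.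

Definition initial (w : seq Sigma) : config :=
  (start M,
   [ffun j => ([::], if j == ord0 then [seq Some (inl x) | x <- w] else [::])]).

Definition step (c : config) : config :=
  if verdict c.1 is Some _ then c else
  let: (q, act) := transition c.1 [ffun j => tape_read (c.2 j)] in
  (q, [ffun j => tape_move (act j).2 (tape_write (act j).1 (c.2 j))]).

Definition answer_within (T : nat) (w : seq Sigma) : option bool :=
  verdict (iter T step (initial w)).1.

End Execution.

Record decision_problem (Sigma : finType) := DecisionProblem {
  instance : Type;
  encode : instance -> seq Sigma;
  yes_instance : instance -> Prop
}.

Definition polytime_decidable (Sigma : finType) (Q : decision_problem Sigma) :=
  exists (M : machine Sigma) (p : {poly nat}), forall x : instance Q,
    exists b : bool, (b <-> yes_instance x) /\
      answer_within M p.[size (encode x)] (encode x) = Some b.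

(* Probabilities are rational, as they have to be written in the input.       *)
Record stoch_problem := StochProblem {
  action : finType;
  dim : nat;
  coord : 'I_dim -> finType;
  utility : action -> {dffun forall i, coord i} -> rat;
  prob : {dffun forall i, coord i} -> rat;
  prob_ge0 : forall s, 0 <= prob s;
  prob_sum1 : \sum_s prob s = 1
}.

Definition argmax (A : finType) (f : A -> rat) : {set A} :=
  [set a | [forall b, f b <= f a]].

Section Sufficiency.
Variable D : stoch_problem.

Definition state : finType := {dffun forall i, @coord D i}.

Definition partial_state (I : {set 'I_(dim D)}) : finType :=
  {dffun forall i : {i | i \in I}, @coord D (val i)}.

Definition restrict (I : {set 'I_(dim D)}) (s : state) : partial_state I :=
  [ffun i : {i | i \in I} => s (val i)].

Definition Opt (s : state) : {set action D} := argmax (fun a => utility a s).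

Definition Opt_stoch (I : {set 'I_(dim D)}) (alpha : partial_state I) :
    {set action D} :=
  argmax (fun a => \sum_(s : state | restrict I s == alpha)
                      prob s * utility a s).

Definition stoch_sufficient (I : {set 'I_(dim D)}) : Prop :=
  forall s : state, Opt_stoch (restrict I s) = Opt s.

Definition has_stoch_anchor (I : {set 'I_(dim D)}) : Prop :=
  exists s0 : state, forall s : state,
    restrict I s = restrict I s0 -> Opt_stoch (restrict I s) = Opt s.

End Sufficiency.

Inductive symbol := Bit of bool | Minus | Slash | Comma | Semicolon.

Definition symbol_code (x : symbol) : bool + 'I_4 :=
  match x with
  | Bit b => inl b
  | Minus => inr (@Ordinal 4 0 isT)
  | Slash => inr (@Ordinal 4 1 isT)
  | Comma => inr (@Ordinal 4 2 isT)
  | Semicolon => inr (@Ordinal 4 3 isT)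
  end.

Definition symbol_decode (x : bool + 'I_4) : symbol :=
  match x with
  | inl b => Bit b
  | inr i => nth Semicolon [:: Minus; Slash; Comma] i
  end.

Lemma symbol_codeK : cancel symbol_code symbol_decode.
Proof. by case. Qed.

HB.instance Definition _ := Countable.copy symbol (can_type symbol_codeK).
HB.instance Definition _ : isFinite symbol := CanIsFinite symbol_codeK.

(* Binary digits, least significant first, without superfluous zeros; 0 is    *)
(* written as the single digit 0.                                             *)
Definition encode_nat (n : nat) : seq symbol :=
  [seq Bit (odd (n %/ 2 ^ i)) | i <- iota 0 (trunc_log 2 n).+1].

Definition encode_rat (q : rat) : seq symbol :=
  (if q < 0 then [:: Minus] else [::]) ++
  encode_nat `|numq q|%N ++ Slash :: encode_nat `|denq q|%N.

(* The explicit-state encoding: one row per state s, listing the coordinates  *)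
(* of s (each value of X_i being named by its rank in X_i), then P(s), then   *)
(* U(a, s) for all actions a.                                                 *)
Definition encode_row (D : stoch_problem) (s : state D) : seq symbol :=
  flatten [seq encode_nat (enum_rank (s i)) ++ [:: Comma]
          | i <- enum 'I_(dim D)] ++ Semicolon ::
  encode_rat (prob s) ++ Semicolon ::
  flatten [seq encode_rat (utility a s) ++ [:: Comma]
          | a <- enum (action D)] ++ [:: Semicolon].

Definition encode_problem (D : stoch_problem) : seq symbol :=
  flatten [seq encode_row s | s <- enum (state D)].

Definition encode_subset (n : nat) (I : {set 'I_n}) : seq symbol :=
  [seq Bit (i \in I) | i <- enum 'I_n].

Definition stoch_minimum_preservation : decision_problem symbol :=
  @DecisionProblem symbol (stoch_problem * nat)
    (fun x => encode_nat x.2 ++ Semicolon :: encode_problem x.1)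
    (fun x => exists I : {set 'I_(dim x.1)},
                stoch_sufficient I /\ (#|I| <= x.2)%N).

Definition stoch_anchor_preservation : decision_problem symbol :=
  @DecisionProblem symbol {D : stoch_problem & {set 'I_(dim D)}}
    (fun x => encode_subset (projT2 x) ++ Semicolon :: encode_problem (projT1 x))
    (fun x => has_stoch_anchor (projT2 x)).

(* Main.v *)
From mathcomp Require Import all_boot all_order all_algebra zify ring lra.
Require Import Defs.

Set Implicit Arguments.
Unset Strict Implicit.
Unset Printing Implicit Defensive.

Import Order.TTheory GRing.Theory Num.Theory.

(* A coordinate with a single value never matters for sufficiency. The other coordinates
   number at most log |S|, and each set of them is the set of coordinates of nonzero rank of
   some state t; so the states themselves enumerate all candidate sets I, and testing one
   candidate takes polynomially many comparisons of sums of fractions, whose numerators and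
   denominators have length linear in the input. An anchor is found by testing every state.

   To run this on a Turing machine, three tapes are used as stacks. Data are binary trees in
   prefix code, and a tree program acts on the tree on top of the first stack without
   touching what lies below. Such programs compose, and they are closed under iteration over
   a list as long as the accumulator keeps polynomial size. *)

(** * Stack programs and their compilation to Turing machines *)

(** The obstacle is the size of intermediate values. A loop whose body runs in polynomial time may
    still square its accumulator in every round, so [polytime_foldl] requires a polynomial bound on
    all intermediate accumulators. It usually comes from a measure that each round increases by an
    amount independent of the accumulator. For the sum over a fiber this measure is the bit length
    of a fraction that is never reduced. Adding a term must count the length of the accumulated sum
    with factor 1; the definitions of multiplication and of [add_frac] are arranged for that.

    A fraction has a positive and a negative part instead of a sign, so only addition,
    multiplication and comparison of natural numbers have to be programmed. The sums over fibers are
    compared without normalization, hence fibers of probability zero need no case of their own. The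
    bound on the cardinality arrives in binary and may be exponential in the length of the input, so
    cardinalities are counted in binary as well. *)

Definition letter : Type := (symbol + void)%type.
Definition test := option letter -> bool.
Definition reg := 'I_3.
Definition main : reg := @Ordinal 3 0 isT.
Definition stash : reg := @Ordinal 3 1 isT.
Definition cntr : reg := @Ordinal 3 2 isT.

Definition stacks : Type := (seq letter * seq letter * seq letter)%type.

Definition get (s : stacks) (r : reg) : seq letter :=
  match val r with 0 => s.1.1 | 1 => s.1.2 | _ => s.2 end.

Definition set (s : stacks) (r : reg) (w : seq letter) : stacks :=
  match val r with
  | 0 => (w, s.1.2, s.2) | 1 => (s.1.1, w, s.2) | _ => (s.1, w)
  end.

Lemma get_set s r w r' : get (set s r w) r' = if r' == r then w else get s r'.
Proof. by case: s => [[x y] z]; case: r => [[|[|[|]]]] //; case: r' => [[|[|[|]]]]. Qed.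

Inductive prog : Type :=
| Skip
| Push of reg & letter
| Pop of reg
| Seq of prog & prog
| If of reg & test & prog & prog
| While of reg & test & prog.

(** The counts are exact numbers of machine steps: a push takes two, each test takes one, and
    sequencing takes none because the last step of [p] already enters [q]. *)
Inductive exec : prog -> stacks -> nat -> stacks -> Prop :=
| ExSkip s : exec Skip s 1 s
| ExPush r g s : exec (Push r g) s 2 (set s r (g :: get s r))
| ExPop r s : exec (Pop r) s 1 (set s r (behead (get s r)))
| ExSeq p q s s1 s2 t1 t2 :
    exec p s t1 s1 -> exec q s1 t2 s2 -> exec (Seq p q) s (t1 + t2) s2
| ExIfT r (c : test) p q s t s' : c (ohead (get s r)) ->
    exec p s t s' -> exec (If r c p q) s t.+1 s'
| ExIfF r (c : test) p q s t s' : ~~ c (ohead (get s r)) ->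
    exec q s t s' -> exec (If r c p q) s t.+1 s'
| ExWhileT r (c : test) p s s1 s2 t1 t2 : c (ohead (get s r)) ->
    exec p s t1 s1 -> exec (While r c p) s1 t2 s2 ->
    exec (While r c p) s (t1 + t2).+1 s2
| ExWhileF r (c : test) p s : ~~ c (ohead (get s r)) -> exec (While r c p) s 1 s.

Definition stacks_size (s : stacks) := size s.1.1 + size s.1.2 + size s.2.

(** Only a push lengthens a stack, by one letter in two steps. This later bounds the size of an
    output by the running time. *)
Lemma exec_size p s t s' : exec p s t s' -> stacks_size s' <= stacks_size s + t.
Proof.
elim=> {p s t s'} //; rewrite /stacks_size /=; try by lia.
- by move=> r g [[x y] z]; case: r => [[|[|[|]]]] //= ?; rewrite /get /=; lia.
- by move=> r [[x y] z]; case: r => [[|[|[|]]]] //= ?; rewrite size_behead /get /=; lia.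
Qed.

(** The additional state [None] of [If] and [While] is the one that performs the test. *)
Fixpoint ctrl (p : prog) : finType :=
  match p with
  | Skip => unit
  | Push _ _ => bool
  | Pop _ => unit
  | Seq p q => (ctrl p + ctrl q)%type
  | If _ _ p q => option (ctrl p + ctrl q)%type
  | While _ _ p => option (ctrl p)
  end.

Fixpoint entry (p : prog) : ctrl p :=
  match p with
  | Skip => tt
  | Push _ _ => false
  | Pop _ => tt
  | Seq p q => inl (entry p)
  | If _ _ p q => None
  | While _ _ p => None
  end.

Definition scanned := {ffun reg -> cell symbol void}.
Definition tape_action := {ffun reg -> cell symbol void * move}.

Definition idle (rd : scanned) : tape_action := [ffun j => (rd j, Stay)].

Definition act1 (rd : scanned) (r : reg) (x : cell symbol void * move) : tape_action :=
  [ffun j => if j == r then x else (rd j, Stay)].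

(** A first component [None] means that the program is left after the action. The top of a stack
    lies under the head: a push moves left and then writes, a pop blanks the cell and moves
    right. *)
Fixpoint next (p : prog) : ctrl p -> scanned -> option (ctrl p) * tape_action :=
  match p with
  | Skip => fun _ rd => (None, idle rd)
  | Push r g => fun q rd =>
      if q : bool then (None, act1 rd r (Some g, Stay))
      else (Some true, act1 rd r (rd r, MoveL))
  | Pop r => fun _ rd => (None, act1 rd r (None, MoveR))
  | Seq p1 p2 => fun q rd =>
      match q with
      | inl q1 => let: (o, a) := next q1 rd in
          (Some (if o is Some q' then inl q' else inr (entry p2)), a)
      | inr q2 => let: (o, a) := next q2 rd in (omap inr o, a)
      end
  | If r c p1 p2 => fun q rd =>
      match q with
      | None =>
          (Some (Some (if c (rd r) then inl (entry p1) else inr (entry p2))), idle rd)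
      | Some (inl q1) => let: (o, a) := next q1 rd in (omap (fun x => Some (inl x)) o, a)
      | Some (inr q2) => let: (o, a) := next q2 rd in (omap (fun x => Some (inr x)) o, a)
      end
  | While r c p1 => fun q rd =>
      match q with
      | None => (if c (rd r) then Some (Some (entry p1)) else None, idle rd)
      | Some q1 => let: (o, a) := next q1 rd in (Some o, a)
      end
  end.

Definition tapes := {ffun reg -> tape letter}.

Definition scan (T : tapes) : scanned := [ffun j => tape_read (T j)].

Definition perform (a : tape_action) (T : tapes) : tapes :=
  [ffun j => tape_move (a j).2 (tape_write (a j).1 (T j))].

Inductive reach (p : prog) : ctrl p -> tapes -> nat -> tapes -> Prop :=
| ReachExit q T a : next q (scan T) = (None, a) -> reach q T 1 (perform a T)
| ReachStep q T q' a n T' : next q (scan T) = (Some q', a) ->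
    reach q' (perform a T) n T' -> reach q T n.+1 T'.

(** Blanks on the left are cells vacated by pops; blanks at the right end arise when the blank read
    on an exhausted tape is written back. The machine sees neither, so their numbers are left
    open. *)
Definition holds_stack (t : tape letter) (w : seq letter) :=
  exists m n, t = (nseq m None, [seq Some x | x <- w] ++ nseq n None).

Definition represents (T : tapes) (s : stacks) :=
  forall r, holds_stack (T r) (get s r).

Lemma holds_read t w : holds_stack t w -> tape_read t = ohead w.
Proof. by case=> m [n ->]; case: w => [|x w] //; case: n. Qed.

Lemma represents_scan T s r : represents T s -> scan T r = ohead (get s r).
Proof. by move=> /(_ r) H; rewrite ffunE (holds_read H). Qed.

Lemma holds_idle t w : holds_stack t w ->
  holds_stack (tape_move Stay (tape_write (tape_read t) t)) w.
Proof.
case=> m [n ->]; case: w => [|x w] /=; last by exists m, n.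
case: n => [|n]; last by exists m, n.+1.
by exists m, 1.
Qed.

Lemma represents_idle T s : represents T s -> represents (perform (idle (scan T)) T) s.
Proof. by move=> H r; rewrite !ffunE; apply: holds_idle. Qed.

Lemma represents_act1 T s r x w : represents T s ->
  holds_stack (tape_move x.2 (tape_write x.1 (T r))) w ->
  represents (perform (act1 (scan T) r x) T) (set s r w).
Proof.
move=> H Hw r'; rewrite get_set !ffunE; case: eqP => [->//|_].
exact: holds_idle.
Qed.

Lemma reach_seqr p1 p2 (q : ctrl p2) T n T' :
  reach q T n T' -> @reach (Seq p1 p2) (inr q) T n T'.
Proof.
elim=> {q T n T'} [q T a E | q T q' a n T' E _ IH].
  by apply: ReachExit; rewrite /= E.
by apply: ReachStep IH; rewrite /= E.
Qed.

Lemma reach_seql p1 p2 (q : ctrl p1) T n T' m T'' :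
  reach q T n T' -> reach (entry p2) T' m T'' ->
  @reach (Seq p1 p2) (inl q) T (n + m) T''.
Proof.
move=> H; elim: H => {q T n T'} [q T a E | q T q' a n T' E _ IH] H2.
  by apply: (@ReachStep (Seq p1 p2) _ _ (inr (entry p2)) a); rewrite /= ?E //; apply: reach_seqr.
by apply: (@ReachStep (Seq p1 p2) _ _ (inl q') a); rewrite /= ?E //; apply: IH.
Qed.

Lemma reach_ifl r c p1 p2 (q : ctrl p1) T n T' :
  reach q T n T' -> @reach (If r c p1 p2) (Some (inl q)) T n T'.
Proof.
elim=> {q T n T'} [q T a E | q T q' a n T' E _ IH].
  by apply: ReachExit; rewrite /= E.
by apply: ReachStep IH; rewrite /= E.
Qed.

Lemma reach_ifr r c p1 p2 (q : ctrl p2) T n T' :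
  reach q T n T' -> @reach (If r c p1 p2) (Some (inr q)) T n T'.
Proof.
elim=> {q T n T'} [q T a E | q T q' a n T' E _ IH].
  by apply: ReachExit; rewrite /= E.
by apply: ReachStep IH; rewrite /= E.
Qed.

Lemma reach_while r c p (q : ctrl p) T n T' m T'' :
  reach q T n T' -> @reach (While r c p) None T' m T'' ->
  @reach (While r c p) (Some q) T (n + m) T''.
Proof.
move=> H; elim: H => {q T n T'} [q T a E | q T q' a n T' E _ IH] H2.
  by apply: (@ReachStep (While r c p) _ _ None a); rewrite /= ?E.
by apply: (@ReachStep (While r c p) _ _ (Some q') a); rewrite /= ?E //; apply: IH.
Qed.

Lemma exec_reach p s t s' : exec p s t s' -> forall T, represents T s ->
  exists2 T', reach (entry p) T t T' & represents T' s'.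
Proof.
elim=> {p s t s'}.
- move=> s T HT; exists (perform (idle (scan T)) T); first exact: ReachExit.
  exact: represents_idle.
- move=> r g s T HT.
  have [m [n E]] := HT r.
  pose T1 := perform (act1 (scan T) r (scan T r, MoveL)) T.
  pose T2 := perform (act1 (scan T1) r (Some g, Stay)) T1.
  exists T2; first by apply: (@ReachStep (Push r g)) => //; apply: ReachExit.
  move=> r'; rewrite get_set /T2 /T1 !ffunE; case: eqP => [->|_].
    rewrite /= E.
    (* The first step of the push writes the scanned cell back. If the right part is exhausted, this
       leaves one explicit blank behind, hence the second witness [1]. *)
    case: m {E} => [|m]; case: (get s r) => [|x w]; case: n => [|n];
      [exists 0,1|exists 0, n.+1|exists 0, 0|exists 0, n.+1
      |exists m, 1|exists m, n.+1|exists m, 0|exists m, n.+1] => //=.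
  exact: (holds_idle (holds_idle (HT r'))).
- move=> r s T HT; exists (perform (act1 (scan T) r (None, MoveR)) T); first exact: ReachExit.
  apply: represents_act1 => //=; have [m [n ->]] := HT r.
  by case: (get s r) => [|x w] /=; [exists m.+1, n.-1; case: n|exists m.+1, n].
- move=> p q s s1 s2 t1 t2 _ IH1 _ IH2 T /IH1 [T1 H1 /IH2 [T2 H2 R2]].
  by exists T2 => //; apply: reach_seql H2.
- move=> r c p q s t s' Hc _ IH T HT.
  have [T' H R'] := IH _ (represents_idle HT); exists T' => //.
  apply: (@ReachStep (If r c p q) _ _ (Some (inl (entry p))) (idle (scan T))).
    by rewrite /= (represents_scan _ HT) Hc.
  exact: reach_ifl.
- move=> r c p q s t s' /negbTE Hc _ IH T HT.
  have [T' H R'] := IH _ (represents_idle HT); exists T' => //.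
  apply: (@ReachStep (If r c p q) _ _ (Some (inr (entry q))) (idle (scan T))).
    by rewrite /= (represents_scan _ HT) Hc.
  exact: reach_ifr.
- move=> r c p s s1 s2 t1 t2 Hc _ IH1 _ IH2 T HT.
  have [T1 H1 /IH2 [T2 H2 R2]] := IH1 _ (represents_idle HT); exists T2 => //.
  apply: (@ReachStep (While r c p) _ _ (Some (entry p)) (idle (scan T))).
    by rewrite /= (represents_scan _ HT) Hc.
  exact: reach_while H2.
- move=> r c p s /negbTE Hc T HT; exists (perform (idle (scan T)) T).
    by apply: ReachExit; rewrite /= (represents_scan _ HT) Hc.
  exact: represents_idle.
Qed.

(** [Bit true] opens a [Node] in the prefix code and also the code of the boolean [true], so one
    test serves for trees, for single bits and for the final answer. *)
Definition is_node (x : option letter) : bool :=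
  if x is Some (inl (Bit true)) then true else false.

(** The state [inl None] is entered when [p] ends; one more step turns the top of [main] into a
    halting state. *)
Definition compile (p : prog) : machine symbol :=
  @Machine symbol 2 void (option (ctrl p) + bool)%type (inl (Some (entry p)))
    (fun q => if q is inr b then Some b else None)
    (fun q rd => match q with
       | inl (Some q) => let: (o, a) := next q rd in (inl o, a)
       | inl None => (inr (is_node (rd main)), idle rd)
       | inr b => (inr b, idle rd)
       end).

Lemma compile_reach p (q : ctrl p) T n T' : reach q T n T' ->
  iter n (@step _ (compile p)) (inl (Some q), T) = (inl None, T').
Proof.
elim=> {q T n T'} [q T a E | q T q' a n T' E _ IH]; last rewrite iterSr -{}IH;
  rewrite /= /step /= -/(scan T) E //.
Qed.

(** [answer_within] inspects one fixed time, so the verdict has to persist after halting. *)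
Lemma halted_stable p n b T :
  (iter n (@step _ (compile p)) (inr b, T)).1 = inr b.
Proof.
by have -> : iter n (@step _ (compile p)) (inr b, T) = (inr b, T) by elim: n => //= n ->.
Qed.

Lemma compile_answer p w t s N :
  exec p ([seq inl x | x <- w], [::], [::]) t s -> t < N ->
  answer_within (compile p) N w = Some (is_node (ohead (get s main))).
Proof.
move=> Hex tN.
pose T0 : tapes := (initial (compile p) w).2.
have HT0 : represents T0 ([seq inl x | x <- w], [::], [::]).
  move=> r; rewrite ffunE; exists 0, 0; rewrite cats0 /=.
  by case: r => [[|[|[|]]]] //= i; rewrite -map_comp.
have [T' HT' R'] := exec_reach Hex HT0.
rewrite /answer_within -(subnK tN) iterD iterS.
have -> : initial (compile p) w = (inl (Some (entry p)), T0) by [].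
rewrite (compile_reach HT') {2}/step /= -/(scan T').
by rewrite -/(step _) halted_stable (represents_scan _ R').
Qed.

(** * Trees on a stack *)

Definition runs p s n s' := exists2 t, t <= n & exec p s t s'.

Lemma runs_le p s n m s' : n <= m -> runs p s n s' -> runs p s m s'.
Proof. by move=> nm [t tn H]; exists t => //; apply: leq_trans nm. Qed.

Lemma runs_skip s : runs Skip s 1 s.
Proof. by exists 1 => //; constructor. Qed.

Lemma runs_push r g s : runs (Push r g) s 2 (set s r (g :: get s r)).
Proof. by exists 2 => //; constructor. Qed.

Lemma runs_pop r s : runs (Pop r) s 1 (set s r (behead (get s r))).
Proof. by exists 1 => //; constructor. Qed.

Lemma runs_push_main g m a c : runs (Push main g) (m, a, c) 2 (g :: m, a, c).
Proof. exact: runs_push. Qed.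
Lemma runs_push_stash g m a c : runs (Push stash g) (m, a, c) 2 (m, g :: a, c).
Proof. exact: runs_push. Qed.
Lemma runs_push_cntr g m a c : runs (Push cntr g) (m, a, c) 2 (m, a, g :: c).
Proof. exact: runs_push. Qed.
Lemma runs_pop_main g m a c : runs (Pop main) (g :: m, a, c) 1 (m, a, c).
Proof. exact: (runs_pop main (g :: m, a, c)). Qed.
Lemma runs_pop_stash g m a c : runs (Pop stash) (m, g :: a, c) 1 (m, a, c).
Proof. exact: (runs_pop stash (m, g :: a, c)). Qed.
Lemma runs_pop_cntr g m a c : runs (Pop cntr) (m, a, g :: c) 1 (m, a, c).
Proof. exact: (runs_pop cntr (m, a, g :: c)). Qed.

Lemma runs_seq p q s s1 s2 n1 n2 :
  runs p s n1 s1 -> runs q s1 n2 s2 -> runs (Seq p q) s (n1 + n2) s2.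
Proof.
move=> [t1 l1 H1] [t2 l2 H2]; exists (t1 + t2); first exact: leq_add.
by apply: ExSeq H1 H2.
Qed.

Lemma runs_if_true r (c : test) p q s n s' : c (ohead (get s r)) ->
  runs p s n s' -> runs (If r c p q) s n.+1 s'.
Proof. by move=> Hc [t l H]; exists t.+1 => //; apply: ExIfT. Qed.

Lemma runs_if_false r (c : test) p q s n s' : ~~ c (ohead (get s r)) ->
  runs q s n s' -> runs (If r c p q) s n.+1 s'.
Proof. by move=> Hc [t l H]; exists t.+1 => //; apply: ExIfF. Qed.

Lemma runs_while_true r (c : test) p s s1 s2 n1 n2 : c (ohead (get s r)) ->
  runs p s n1 s1 -> runs (While r c p) s1 n2 s2 ->
  runs (While r c p) s (n1 + n2).+1 s2.
Proof.
move=> Hc [t1 l1 H1] [t2 l2 H2]; exists (t1 + t2).+1; first by rewrite ltnS leq_add.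
by apply: ExWhileT H1 H2.
Qed.

Lemma runs_while_false r (c : test) p s : ~~ c (ohead (get s r)) -> runs (While r c p) s 1 s.
Proof. by move=> Hc; exists 1 => //; apply: ExWhileF. Qed.

Inductive tree := Leaf | Node of tree & tree.

Fixpoint bits (x : tree) : seq bool :=
  if x is Node l r then true :: bits l ++ bits r else [:: false].

Definition letter_of (b : bool) : letter := inl (Bit b).
Definition mark : letter := inl Comma.

Definition code (x : tree) : seq letter := map letter_of (bits x).

Definition tsize (x : tree) := size (bits x).

Lemma tsize_node l r : tsize (Node l r) = (tsize l + tsize r).+1.
Proof. by rewrite /tsize /= size_cat. Qed.

Lemma tsize_gt0 x : 0 < tsize x.
Proof. by case: x. Qed.

Lemma code_node l r w : code (Node l r) ++ w = letter_of true :: code l ++ code r ++ w.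
Proof. by rewrite /code /= map_cat catA. Qed.

Lemma code_leaf w : code Leaf ++ w = letter_of false :: w.
Proof. by []. Qed.

Definition is_bit (o : option letter) : bool :=
  if o is Some (inl (Bit _)) then true else false.

Definition per_bit r (f : bool -> prog) : prog :=
  If r is_node (Seq (Pop r) (f true)) (Seq (Pop r) (f false)).

Lemma runs_per_bit r f s n s' b w : get s r = letter_of b :: w ->
  runs (f b) (set s r w) n s' -> runs (per_bit r f) s n.+2 s'.
Proof.
move=> E H.
have E' : runs (Pop r) s 1 (set s r w) by have := runs_pop r s; rewrite E.
case: b E H => E H; [apply: runs_if_true | apply: runs_if_false];
  rewrite ?E //; exact: (runs_seq E' H).
Qed.

Definition stash_step : prog :=
  per_bit main (fun b => Seq (Push stash (letter_of b))
                             (if b then Push cntr mark else Pop cntr)).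

Definition stash_loop : prog := While cntr isSome stash_step.

(** The reversed code is not self-delimiting, so a [mark] beneath it shows later loops where the
    value ends. The mark on the counter stands for the one tree to be read. *)
Definition stash_value : prog :=
  Seq (Push stash mark) (Seq (Push cntr mark) stash_loop).

(* The height of the counter stack is the number of subtrees still to be read. *)
Lemma runs_stash_loop x w a c n s' :
  runs stash_loop (w, rev (code x) ++ a, c) n s' ->
  runs stash_loop (code x ++ w, a, mark :: c) (7 * tsize x + n) s'.
Proof.
elim: x w a c n => [|l IHl r IHr] w a c n H.
  rewrite code_leaf; apply: runs_le (runs_while_true _ _ H) => //.
    by rewrite /tsize /=; exact: (leqnn (6 + n).+1).
  apply: runs_le (_ : 5 <= 6) _ => //.
  apply: (@runs_per_bit main _ _ 3 _ false w) => //=.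
  exact: runs_seq (runs_push_stash _ _ _ _) (runs_pop_cntr _ _ _ _).
rewrite code_node tsize_node.
(* Because the statement takes the rest of the run as a hypothesis, one loop can pass from [l] to
   [r]. The bit opening the node turns one pending subtree into two. *)
have {}H : runs stash_loop (code l ++ code r ++ w, letter_of true :: a, mark :: mark :: c)
     (7 * tsize l + (7 * tsize r + n)) s'.
  apply/IHl/IHr; move: H; rewrite /code /= map_cat rev_cons rev_cat.
  by rewrite -cats1 -!catA.
apply: runs_le (runs_while_true (n1 := 6) _ _ H) => //; first by lia.
apply: (@runs_per_bit main _ _ 4 _ true) => //=.
exact: runs_seq (runs_push_stash _ _ _ _) (runs_push_cntr _ _ _ _).
Qed.

Lemma runs_stash_value x w a :
  runs stash_value (code x ++ w, a, [::]) (7 * tsize x + 5)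
       (w, rev (code x) ++ mark :: a, [::]).
Proof.
apply: runs_le (runs_seq (runs_push_stash _ _ _ _)
  (runs_seq (runs_push_cntr _ _ _ _) (runs_stash_loop (n := 1) _))).
  by lia.
exact: runs_while_false.
Qed.

Definition unstash_loop : prog :=
  While stash is_bit (per_bit stash (fun b => Push main (letter_of b))).

Definition unstash_value : prog := Seq unstash_loop (Pop stash).

Lemma runs_unstash_loop v m a c :
  runs unstash_loop (m, map letter_of v ++ mark :: a, c) (5 * size v + 1)
       (map letter_of (rev v) ++ m, mark :: a, c).
Proof.
elim: v m => [|b v IH] m /=; first exact: runs_while_false.
rewrite rev_cons -cats1 map_cat -catA.
apply: runs_le (runs_while_true (n1 := 4) _ _ (IH _)) => //; first by lia.
apply: (@runs_per_bit stash _ _ 2 _ b) => //=.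
exact: runs_push_main.
Qed.

Lemma runs_unstash_value x m a c :
  runs unstash_value (m, rev (code x) ++ mark :: a, c) (5 * tsize x + 2)
       (code x ++ m, a, c).
Proof.
have := runs_unstash_loop (rev (bits x)) m a c.
rewrite size_rev revK map_rev => H.
by apply: runs_le (runs_seq H (runs_pop_stash _ _ _ _)); rewrite /tsize; lia.
Qed.

Definition drop_loop : prog := While stash is_bit (Pop stash).

Definition drop_value : prog := Seq stash_value (Seq drop_loop (Pop stash)).

Lemma runs_drop_loop v m a c :
  runs drop_loop (m, map letter_of v ++ mark :: a, c) (2 * size v + 1) (m, mark :: a, c).
Proof.
elim: v => [|b v IH] /=; first exact: runs_while_false.
apply: runs_le (runs_while_true (n1 := 1) _ _ IH) => //; first by lia.
exact: runs_pop_stash.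
Qed.

Lemma runs_drop_value x w a :
  runs drop_value (code x ++ w, a, [::]) (9 * tsize x + 7) (w, a, [::]).
Proof.
have := runs_drop_loop (rev (bits x)) w a [::].
rewrite size_rev map_rev => H.
apply: runs_le (runs_seq (runs_stash_value _ _ _)
  (runs_seq H (runs_pop_stash _ _ _ _))).
by rewrite /tsize; lia.
Qed.

Definition copy_loop : prog :=
  While stash is_bit (per_bit stash (fun b =>
    Seq (Push main (letter_of b)) (Push cntr (letter_of b)))).

Definition restash_loop : prog :=
  While cntr isSome (per_bit cntr (fun b => Push stash (letter_of b))).

(** Popping the stash destroys the value, so [copy_loop] writes it to [main] and, as a buffer, to
    the counter. [restash_loop] reverses the buffer back onto the stash, above the surviving [mark],
    and it is unstashed from there as the second copy. *)
Definition dup_value : prog :=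
  Seq stash_value (Seq copy_loop (Seq restash_loop unstash_value)).

Lemma runs_copy_loop v m a c :
  runs copy_loop (m, map letter_of v ++ mark :: a, c) (7 * size v + 1)
       (map letter_of (rev v) ++ m, mark :: a, map letter_of (rev v) ++ c).
Proof.
elim: v m c => [|b v IH] m c /=; first exact: runs_while_false.
rewrite rev_cons -cats1 map_cat -!catA.
apply: runs_le (runs_while_true (n1 := 6) _ _ (IH _ _)) => //; first by lia.
apply: (@runs_per_bit stash _ _ 4 _ b) => //=.
exact: runs_seq (runs_push_main _ _ _ _) (runs_push_cntr _ _ _ _).
Qed.

Lemma runs_restash_loop v m a :
  runs restash_loop (m, a, map letter_of v) (5 * size v + 1)
       (m, map letter_of (rev v) ++ a, [::]).
Proof.
elim: v a => [|b v IH] a /=; first exact: runs_while_false.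
rewrite rev_cons -cats1 map_cat -!catA.
apply: runs_le (runs_while_true (n1 := 4) _ _ (IH _)) => //; first by lia.
apply: (@runs_per_bit cntr _ _ 2 _ b) => //=.
exact: runs_push_stash.
Qed.

Lemma runs_dup_value x w a :
  runs dup_value (code x ++ w, a, [::]) (24 * tsize x + 9)
       (code x ++ code x ++ w, a, [::]).
Proof.
have H1 := runs_stash_value x w a.
have H2 : runs copy_loop (w, rev (code x) ++ mark :: a, [::]) (7 * tsize x + 1)
    (code x ++ w, mark :: a, code x).
  have := runs_copy_loop (rev (bits x)) w a [::].
  by rewrite size_rev revK cats0 map_rev.
have H3 : runs restash_loop (code x ++ w, mark :: a, code x) (5 * tsize x + 1)
    (code x ++ w, rev (code x) ++ mark :: a, [::]).
  by rewrite /code -map_rev; apply: runs_restash_loop.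
have H4 := runs_unstash_value x (code x ++ w) a [::].
by apply: runs_le (runs_seq H1 (runs_seq H2 (runs_seq H3 H4))); lia.
Qed.

(** The base is at least 2 for every [n], so its powers absorb constants and sums. *)
Definition polyb (f : nat -> nat) := exists k, forall n, f n <= (n + 2) ^ k.

Lemma polyb_le f g : (forall n, f n <= g n) -> polyb g -> polyb f.
Proof. by move=> fg [k H]; exists k => n; apply: leq_trans (fg n) (H n). Qed.

Lemma polyb_const c : polyb (fun=> c).
Proof.
exists c => n; apply: leq_trans (ltnW (ltn_expl c (ltnSn 1))) _.
by case: c => [|c] //; rewrite leq_exp2r //; lia.
Qed.

Lemma polyb_id : polyb id.
Proof. by exists 1 => n; rewrite expn1 leq_addr. Qed.

Lemma polyb_mul f g : polyb f -> polyb g -> polyb (fun n => f n * g n).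
Proof. by move=> [k H] [l K]; exists (k + l) => n; rewrite expnD leq_mul. Qed.

Lemma polyb_add f g : polyb f -> polyb g -> polyb (fun n => f n + g n).
Proof.
move=> [k H] [l K]; exists (k + l).+1 => n.
apply: leq_trans (_ : (n + 2) ^ (k + l) * 2 <= _); last first.
  by rewrite expnS mulnC leq_mul // leq_addl.
rewrite muln2 -addnn; apply: leq_add; [apply: leq_trans (H n) _|apply: leq_trans (K n) _];
  by rewrite leq_pexp2l ?addn2 // ?leq_addr ?leq_addl.
Qed.

Lemma polyb_exp f k : polyb f -> polyb (fun n => f n ^ k).
Proof.
elim: k => [|k IH] H; first exact: polyb_const 1.
by apply: polyb_le (polyb_mul H (IH H)) => n; rewrite expnS.
Qed.

Ltac polyb_solve := repeat first
  [ exact: polyb_const | exact: polyb_id | assumption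
  | apply: polyb_add | apply: polyb_mul | apply: polyb_exp ].

(** * Polynomial-time functions *)

Class encodable (T : Type) := to_tree : T -> tree.

Definition esize {T} `{encodable T} (x : T) : nat := tsize (to_tree x).

#[global] Instance encodable_unit : encodable unit := fun=> Leaf.
#[global] Instance encodable_bool : encodable bool :=
  fun b => if b then Node Leaf Leaf else Leaf.
#[global] Instance encodable_prod A B `{encodable A} `{encodable B} :
  encodable (A * B) := fun p => Node (to_tree p.1) (to_tree p.2).
#[global] Instance encodable_seq A `{encodable A} : encodable (seq A) :=
  fix seq_tree s := if s is x :: s' then Node (to_tree x) (seq_tree s') else Leaf.
(* Unary: natural numbers serve as indices and lengths only, the numbers of the input are
   bit strings. *)
#[global] Instance encodable_nat : encodable nat :=
  fun n => to_tree (nseq n tt).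

Lemma esize_pair A B `{encodable A} `{encodable B} (p : A * B) :
  esize p = (esize p.1 + esize p.2).+1.
Proof. exact: tsize_node. Qed.

Lemma esize_cons A `{encodable A} (x : A) s : esize (x :: s) = (esize x + esize s).+1.
Proof. exact: tsize_node. Qed.

Lemma esize_nil A `{encodable A} : esize (@nil A) = 1.
Proof. by []. Qed.

Lemma esize_bool (b : bool) : esize b <= 3.
Proof. by case: b. Qed.

Lemma esize_gt0 A `{encodable A} (x : A) : 0 < esize x.
Proof. exact: tsize_gt0. Qed.

Lemma esize_nat n : esize n = n.*2.+1.
Proof.
have -> : esize n = esize (nseq n tt) by [].
by elim: n => // n IH; rewrite esize_cons IH /esize /tsize /= doubleS.
Qed.

Lemma size_esize A `{encodable A} (s : seq A) : size s < esize s.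
Proof. by elim: s => //= x s IH; rewrite esize_cons; lia. Qed.

Lemma esize_cat A `{encodable A} (s t : seq A) : esize (s ++ t) = (esize s + esize t).-1.
Proof.
elim: s => [|x s IH] //; rewrite cat_cons !esize_cons IH.
have : 0 < esize s by exact: esize_gt0.
by lia.
Qed.

Lemma esize_rev A `{encodable A} (s : seq A) : esize (rev s) = esize s.
Proof.
elim: s => // x s IH; rewrite rev_cons -cats1 esize_cat !esize_cons esize_nil IH.
have : 0 < esize s by exact: esize_gt0.
by lia.
Qed.

Lemma esize_take A `{encodable A} i (s : seq A) : esize (take i s) <= esize s.
Proof.
rewrite -{2}(cat_take_drop i s) esize_cat.
have : 0 < esize (drop i s) by exact: esize_gt0.
by lia.
Qed.

(* The contents of the stash and of the main stack below the argument are arbitrary, so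
   that a program can be run in the middle of another one; the counter is empty between
   operations. *)
Definition polytime {A B} `{encodable A} `{encodable B} (f : A -> B) :=
  exists p k, forall x w a,
    runs p (code (to_tree x) ++ w, a, [::]) ((esize x + 2) ^ k)
           (code (to_tree (f x)) ++ w, a, [::]).

Lemma polytime_intro A B `{encodable A} `{encodable B} (f : A -> B) p T :
  polyb T ->
  (forall x w a, runs p (code (to_tree x) ++ w, a, [::]) (T (esize x))
           (code (to_tree (f x)) ++ w, a, [::])) -> polytime f.
Proof. by move=> [k Hk] Hp; exists p, k => x w a; apply: runs_le (Hp x w a). Qed.

(** The output lies on [main] at the end of the run, and a run lengthens the stacks by at most its
    number of steps. *)
Lemma polytime_esize A B `{encodable A} `{encodable B} (f : A -> B) : polytime f ->
  exists k, forall x, esize (f x) <= (esize x + 2) ^ k.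
Proof.
move=> [p [k H1]].
have [m Hm] : polyb (fun n => n + (n + 2) ^ k) by polyb_solve.
exists m => x; apply: leq_trans (Hm _).
have [t tn /exec_size] := H1 x [::] [::].
rewrite /stacks_size /= !cats0 !addn0 /code !size_map => H2.
by apply: leq_trans H2 _; rewrite leq_add2l.
Qed.

Lemma polytime_ext A B `{encodable A} `{encodable B} (f g : A -> B) :
  f =1 g -> polytime f -> polytime g.
Proof. by move=> fg [p [k H1]]; exists p, k => x w a; rewrite -fg. Qed.

Lemma polytime_id_code A B `{encodable A} `{encodable B} (f : A -> B) :
  (forall x, to_tree (f x) = to_tree x) -> polytime f.
Proof.
move=> E; apply: (@polytime_intro _ _ _ _ _ Skip (fun=> 1)); first by polyb_solve.
by move=> x w a; rewrite E; apply: runs_skip.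
Qed.

Lemma polytime_id A `{encodable A} : polytime (@id A).
Proof. exact: polytime_id_code. Qed.

Lemma polytime_comp A B C `{encodable A} `{encodable B} `{encodable C}
  (g : B -> C) (f : A -> B) : polytime g -> polytime f -> polytime (fun x => g (f x)).
Proof.
move=> [q [l Hq]] Hf; have [m Hm] := polytime_esize Hf; move: Hf => [p [k Hp]].
apply: (@polytime_intro _ _ _ _ _ (Seq p q) (fun n => (n + 2) ^ k + ((n + 2) ^ m + 2) ^ l)).
  by polyb_solve.
move=> x w a; apply: runs_seq (Hp x w a) (runs_le _ (Hq (f x) w a)).
by case: (l) => [|l'] //; rewrite leq_exp2r // leq_add2r.
Qed.

(** [f x] waits on the stash while [g] consumes the second copy of [x]; this uses that programs
    tolerate an arbitrary stash. The last push is the bit opening the pair. *)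
Lemma polytime_pair A B C `{encodable A} `{encodable B} `{encodable C}
  (f : A -> B) (g : A -> C) : polytime f -> polytime g -> polytime (fun x => (f x, g x)).
Proof.
move=> Hf [q [l Hq]]; have [m Hm] := polytime_esize Hf; move: Hf => [p [k Hp]].
apply: (@polytime_intro _ _ _ _ _
  (Seq dup_value (Seq p (Seq stash_value (Seq q (Seq unstash_value (Push main (letter_of true)))))))
  (fun n => (24 * n + 9) + ((n + 2) ^ k + ((7 * (n + 2) ^ m + 5) + ((n + 2) ^ l +
     ((5 * (n + 2) ^ m + 2) + 2)))))).
  by polyb_solve.
move=> x w a; rewrite code_node.
apply: runs_seq (runs_dup_value _ _ _) _.
apply: runs_seq (Hp x _ a) _.
apply: runs_seq (runs_le _ (runs_stash_value _ _ _)) _.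
  by rewrite leq_add2r leq_mul2l Hm.
apply: runs_seq (Hq x _ _) _.
apply: runs_seq (runs_le _ (runs_unstash_value _ _ _ _)) (runs_push_main _ _ _ _).
by rewrite leq_add2r leq_mul2l Hm.
Qed.

Lemma polytime_fst_id A B `{encodable A} `{encodable B} : polytime (@fst A B).
Proof.
apply: (@polytime_intro _ _ _ _ _
  (Seq (Pop main) (Seq stash_value (Seq drop_value unstash_value)))
  (fun n => 1 + ((7 * n + 5) + ((9 * n + 7) + (5 * n + 2))))); first by polyb_solve.
move=> [x y] w a; rewrite code_node esize_pair /=.
apply: runs_seq (runs_pop_main _ _ _ _) _.
apply: runs_seq (runs_le _ (runs_stash_value _ _ _)) _; first by rewrite /esize; lia.
apply: runs_seq (runs_le _ (runs_drop_value _ _ _)) (runs_le _ (runs_unstash_value _ _ _ _));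
  by rewrite /esize; lia.
Qed.

Lemma polytime_snd_id A B `{encodable A} `{encodable B} : polytime (@snd A B).
Proof.
apply: (@polytime_intro _ _ _ _ _ (Seq (Pop main) drop_value)
  (fun n => 1 + (9 * n + 7))); first by polyb_solve.
move=> [x y] w a; rewrite code_node esize_pair /=.
apply: runs_seq (runs_pop_main _ _ _ _) (runs_le _ (runs_drop_value _ _ _)).
by rewrite /esize; lia.
Qed.

Lemma polytime_fst A B C `{encodable A} `{encodable B} `{encodable C} (f : A -> B * C) :
  polytime f -> polytime (fun x => (f x).1).
Proof. exact: (polytime_comp (@polytime_fst_id _ _ _ _)). Qed.

Lemma polytime_snd A B C `{encodable A} `{encodable B} `{encodable C} (f : A -> B * C) :
  polytime f -> polytime (fun x => (f x).2).
Proof. exact: (polytime_comp (@polytime_snd_id _ _ _ _)). Qed.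

Fixpoint push_bits (v : seq bool) : prog :=
  if v is b :: v' then Seq (push_bits v') (Push main (letter_of b)) else Skip.

Lemma runs_push_bits v w a c :
  runs (push_bits v) (w, a, c) (2 * size v + 1) (map letter_of v ++ w, a, c).
Proof.
elim: v => [|b v IH] /=; first exact: runs_skip.
by apply: runs_le (runs_seq IH (runs_push_main _ _ _ _)); lia.
Qed.

Lemma polytime_const A B `{encodable A} `{encodable B} (y : B) : polytime (fun _ : A => y).
Proof.
apply: (@polytime_intro _ _ _ _ _ (Seq drop_value (push_bits (bits (to_tree y))))
  (fun n => (9 * n + 7) + (2 * size (bits (to_tree y)) + 1))); first by polyb_solve.
move=> x w a; apply: runs_seq (runs_drop_value _ _ _) _; exact: runs_push_bits.
Qed.

Lemma polytime_if A B `{encodable A} `{encodable B} (c : A -> bool) (f g : A -> B) :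
  polytime c -> polytime f -> polytime g -> polytime (fun x => if c x then f x else g x).
Proof.
move=> [pc [j Hc]] [p [k Hp]] [q [l Hq]].
(* [9 * 3 + 7] pays for dropping the boolean, whose tree has size at most 3. *)
apply: (@polytime_intro _ _ _ _ _
  (Seq dup_value (Seq pc (If main is_node (Seq drop_value p) (Seq drop_value q))))
  (fun n => (24 * n + 9) + ((n + 2) ^ j + ((9 * 3 + 7) + ((n + 2) ^ k + (n + 2) ^ l) + 1)))).
  by polyb_solve.
move=> x w a; apply: runs_seq (runs_dup_value _ _ _) _.
apply: runs_seq (Hc x _ a) _; rewrite [X in runs _ _ X _]addn1.
have D (b : bool) : runs drop_value (code (to_tree b) ++ code (to_tree x) ++ w, a, [::]) (9 * 3 + 7)
   (code (to_tree x) ++ w, a, [::]).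
  apply: runs_le (runs_drop_value _ _ _).
  by have := esize_bool b; rewrite /esize; lia.
case: (c x) (D (c x)) => Dx.
  by apply: runs_if_true => //; apply: runs_seq Dx (runs_le _ (Hp x w a)); rewrite leq_addr.
by apply: runs_if_false => //; apply: runs_seq Dx (runs_le _ (Hq x w a)); rewrite leq_addl.
Qed.

(** The list [y :: s'] and the pair [(y, s')] have the same tree. When the list lies on top of [x],
    a single pushed bit makes them the argument [(y, s', x)] of [g]. *)
Lemma polytime_case A B C `{encodable A} `{encodable B} `{encodable C}
  (s : A -> seq C) (f : A -> B) (g : C -> seq C -> A -> B) :
  polytime s -> polytime f -> polytime (fun p : C * seq C * A => g p.1.1 p.1.2 p.2) ->
  polytime (fun x => if s x is y :: s' then g y s' x else f x).
Proof.
move=> Hs [p [k Hp]] [q [l Hq]].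
have [m Hm] := polytime_esize Hs; move: Hs => [ps [j Hs]].
apply: (@polytime_intro _ _ _ _ _
  (Seq dup_value (Seq ps (If main is_node (Seq (Push main (letter_of true)) q)
                              (Seq (Pop main) p))))
  (fun n => (24 * n + 9) + ((n + 2) ^ j +
     (2 + ((n + 2) ^ k + ((n + 2) ^ m + n + 1 + 2) ^ l) + 1)))).
  by polyb_solve.
move=> x w a; apply: runs_seq (runs_dup_value _ _ _) _.
apply: runs_seq (Hs x _ a) _; rewrite [X in runs _ _ X _]addn1.
case E: (s x) => [|y s'].
  rewrite code_leaf.
  apply: runs_if_false => //; apply: runs_le (runs_seq (runs_pop_main _ _ _ _) (Hp x w a)).
  by rewrite leq_add // leq_addr.
apply: runs_if_true => //; apply: runs_seq (runs_push_main _ _ _ _) _.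
have := Hq (y, s', x) w a; rewrite [code (to_tree (y, s', x)) ++ w]code_node => H3.
apply: runs_le H3; rewrite esize_pair .
apply: leq_trans (leq_addl _ _); case: (l) => [|l'] //; rewrite leq_exp2r // leq_add2r addn1.
by rewrite ltnS leq_add2r; have := Hm x; rewrite E.
Qed.

(** The remaining list and the accumulator lie one above the other on [main]. Pushing a bit joins
    them into the argument of [p], and popping the opening bit of the resulting pair separates them
    again. The loop stops at the leaf that ends the list. *)
Definition fold_loop (p : prog) : prog :=
  While main is_node (Seq (Push main (letter_of true)) (Seq p (Pop main))).

Lemma runs_fold_loop A B `{encodable A} `{encodable B} (g : B -> A -> B) p k :
  (forall (q : A * seq A * B) w a, runs p (code (to_tree q) ++ w, a, [::]) ((esize q + 2) ^ k)
     (code (to_tree (q.1.2, g q.2 q.1.1)) ++ w, a, [::])) ->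
  forall M s z w a, esize s <= M -> (forall i, esize (foldl g z (take i s)) <= M) ->
  runs (fold_loop p) (code (to_tree s) ++ code (to_tree z) ++ w, a, [::])
    (size s * ((M + M + 3) ^ k + 4) + 1)
    (letter_of false :: code (to_tree (foldl g z s)) ++ w, a, [::]).
Proof.
move=> Hp M; elim=> [|x s IH] z w a sM HM; first exact: runs_while_false.
have {}IH : runs (fold_loop p)
    (code (to_tree s) ++ code (to_tree (g z x)) ++ w, a, [::])
    (size s * ((M + M + 3) ^ k + 4) + 1)
    (letter_of false :: code (to_tree (foldl g (g z x) s)) ++ w, a, [::]).
  by apply: IH => [|i]; [rewrite esize_cons in sM; lia | apply: HM i.+1].
apply: runs_le (runs_while_true (n1 := 2 + ((M + M + 3) ^ k + 1)) _ _ IH) => //.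
  by rewrite /=; lia.
apply: runs_seq (runs_push_main _ _ _ _) _.
have := Hp (x, s, z) w a; rewrite !code_node => H2.
apply: runs_seq (runs_le _ H2) (runs_pop_main _ _ _ _).
(* This is the source of [M + M + 3]: the list, the accumulator, the bit joining them, and the 2 in
   the time bound of [p]. *)
have -> : esize (x, s, z) = (esize (x :: s) + esize z).+1 by apply: esize_pair.
have /= zM := HM 0.
by case: (k) => [|k'] //; rewrite leq_exp2r //; lia.
Qed.

(** Iterating a polynomial-time step can make the accumulator outgrow every polynomial, so [T] has
    to bound it after each prefix of the list. *)
Lemma polytime_foldl A B C `{encodable A} `{encodable B} `{encodable C}
  (s : C -> seq A) (z : C -> B) (g : C -> B -> A -> B) T :
  polytime s -> polytime z ->
  polytime (fun p : C * (B * A) => g p.1 p.2.1 p.2.2) ->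
  polyb T -> (forall x i, esize (foldl (g x) (z x) (take i (s x))) <= T (esize x)) ->
  polytime (fun x => foldl (g x) (z x) (s x)).
Proof.
move=> Hs Hz Hg HT HTs.
(* The loop body sees only the list and the accumulator, so the context [x] travels inside the
   accumulator and is projected away at the end. *)
pose g' (q : C * B) (y : A) := (q.1, g q.1 q.2 y).
have Hfold x t y : foldl g' (x, y) t = (x, foldl (g x) y t).
  by elim: t y => //= b t IH y; rewrite IH.
have [p [k Hp]] : polytime (fun q : (A * seq A) * (C * B) => (q.1.2, g' q.2 q.1.1)).
  have P1 : polytime (fun q : (A * seq A) * (C * B) => q.1) by apply: polytime_fst_id.
  have P2 : polytime (fun q : (A * seq A) * (C * B) => q.2) by apply: polytime_snd_id.
  have P11 := polytime_fst P1; have P12 := polytime_snd P1.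
  have P21 := polytime_fst P2; have P22 := polytime_snd P2.
  apply: polytime_pair => //; apply: polytime_pair => //.
  exact: (polytime_comp Hg (polytime_pair P21 (polytime_pair P22 P11))).
have [m Hm] := polytime_esize Hs.
have [q [l Hq]] := polytime_pair Hs (polytime_pair (@polytime_id C _) Hz).
have Hxf : polytime (fun x => (x, foldl (g x) (z x) (s x))); last exact: polytime_snd Hxf.
pose M n := (n + 2) ^ m + (n + T n + 1).
apply: (@polytime_intro _ _ _ _ _ (Seq q (Seq (Pop main) (Seq (fold_loop p) (Pop main))))
  (fun n => (n + 2) ^ l + (1 + (((n + 2) ^ m * ((M n + M n + 3) ^ k + 4) + 1) + 1)))).
  by rewrite /M; polyb_solve.
move=> x w a; apply: runs_seq (Hq x w a) _.
rewrite code_node; apply: runs_seq (runs_pop_main _ _ _ _) _.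
apply: runs_seq (runs_pop_main (letter_of false) _ _ _); rewrite -Hfold.
apply: runs_le (runs_fold_loop Hp (M := M (esize x)) _ _ _ _).
- rewrite leq_add2r leq_mul2r; apply/orP; right.
  exact: leq_trans (ltnW (size_esize _)) (Hm x).
- by apply: leq_trans (Hm x) _; rewrite leq_addr.
- move=> i; rewrite Hfold esize_pair /M /=.
  by have := HTs x i; lia.
Qed.

(** Increments that do not depend on the accumulator add up to a polynomial. A measure other than
    [esize] is allowed because the tree size of a bit string depends on its bits, a 1 taking more
    room than a 0, whereas its length is easy to control. *)
Lemma polytime_foldl_measure A B C `{encodable A} `{encodable B} `{encodable C}
  (mu : B -> nat) c k l (s : C -> seq A) (z : C -> B) (g : C -> B -> A -> B) :
  polytime s -> polytime z ->
  polytime (fun p : C * (B * A) => g p.1 p.2.1 p.2.2) ->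
  (forall b, esize b <= c * mu b + c) -> (forall x, mu (z x) <= (esize x + 2) ^ l) ->
  (forall x b a, mu (g x b a) <= mu b + (esize x + esize a + 2) ^ k) ->
  polytime (fun x => foldl (g x) (z x) (s x)).
Proof.
move=> Hs Hz Hg Hc Hl Hk; have [m Hm] := polytime_esize Hs.
apply: (@polytime_foldl _ _ _ _ _ _ _ _ _
  (fun n => c * ((n + 2) ^ l + (n + 2) ^ m * (n + (n + 2) ^ m + 2) ^ k) + c)) => //.
  by polyb_solve.
move=> x i; apply: leq_trans (Hc _) _; rewrite leq_add2r leq_mul2l; apply/orP; right.
set K := (X in _ * X).
have main_bound t y : esize t <= (esize x + 2) ^ m ->
    mu (foldl (g x) y t) <= mu y + size t * K.
  elim: t y => [|b t IH] y; first by rewrite addn0.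
  rewrite esize_cons => tm /=; apply: leq_trans (IH _ _) _; first by lia.
  rewrite mulSn addnA leq_add2r; apply: leq_trans (Hk _ _ _) _; rewrite leq_add2l /K.
  case: (k) => // k'; rewrite leq_exp2r //; lia.
have st : esize (take i (s x)) <= (esize x + 2) ^ m.
  exact: leq_trans (esize_take _ _) (Hm x).
apply: leq_trans (main_bound _ _ st) _; apply: leq_add => //.
by rewrite leq_mul2r (leq_trans (ltnW (size_esize _)) st) orbT.
Qed.

Lemma polytime_foldl_additive A B C `{encodable A} `{encodable B} `{encodable C} k
  (s : C -> seq A) (z : C -> B) (g : C -> B -> A -> B) :
  polytime s -> polytime z ->
  polytime (fun p : C * (B * A) => g p.1 p.2.1 p.2.2) ->
  (forall x b a, esize (g x b a) <= esize b + (esize x + esize a + 2) ^ k) ->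
  polytime (fun x => foldl (g x) (z x) (s x)).
Proof.
move=> Hs Hz Hg Hk; have [l Hl] := polytime_esize Hz.
by apply: (@polytime_foldl_measure _ _ _ _ _ _ esize 1 k l) => // b; rewrite mul1n leq_addr.
Qed.

(** Nonempty lists share their trees with pairs, and unary numbers with lists of units; passing
    between such types costs nothing. *)
Lemma polytime_recode A B C `{encodable A} `{encodable B} `{encodable C}
  (f : A -> B) (g : A -> C) :
  (forall x, to_tree (g x) = to_tree (f x)) -> polytime f -> polytime g.
Proof. by move=> E [p [k Hp]]; exists p, k => x w a; rewrite E. Qed.

Lemma polytime_comp2 A B C D `{encodable A} `{encodable B} `{encodable C} `{encodable D}
  (h : B -> C -> D) (f : A -> B) (g : A -> C) :
  polytime (fun p => h p.1 p.2) -> polytime f -> polytime g ->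
  polytime (fun x => h (f x) (g x)).
Proof. by move=> Hh Hf Hg; apply: (polytime_comp Hh (polytime_pair Hf Hg)). Qed.

Lemma polytime_comp3 A B C D E `{encodable A} `{encodable B} `{encodable C}
  `{encodable D} `{encodable E}
  (h : B -> C -> D -> E) (f : A -> B) (g : A -> C) (k : A -> D) :
  polytime (fun p => h p.1.1 p.1.2 p.2) -> polytime f -> polytime g -> polytime k ->
  polytime (fun x => h (f x) (g x) (k x)).
Proof.
move=> Hh Hf Hg Hk.
by apply: (polytime_comp Hh (polytime_pair (polytime_pair Hf Hg) Hk)).
Qed.

Lemma polytime_cons A B `{encodable A} `{encodable B} (f : A -> B) (g : A -> seq B) :
  polytime f -> polytime g -> polytime (fun x => f x :: g x).
Proof. by move=> Hf Hg; apply: polytime_recode (polytime_pair Hf Hg). Qed.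

(** A hook of [polytime_step], redefined once the closure lemmas for booleans, lists and unary
    numbers are available. *)
Ltac polytime_extra := fail.

Ltac polytime_step :=
  match goal with
  | |- polytime (fun x => x) => exact: polytime_id
  | |- polytime fst => exact: polytime_fst_id
  | |- polytime snd => exact: polytime_snd_id
  | |- polytime (fun x => ?c) => exact: polytime_const
  | |- polytime (fun x => if _ then _ else _) => apply: polytime_if
  | |- polytime (fun x => (_, _)) => apply: polytime_pair
  | |- polytime (fun x => _ :: _) => apply: polytime_cons
  | |- polytime (fun x => _.1) => apply: polytime_fst
  | |- polytime (fun x => _.2) => apply: polytime_snd
  | |- _ => polytime_extra
  | |- _ => assumption
  end.

Ltac polytime_solve := repeat polytime_step.

(** * Closure under boolean operations, list operations and unary arithmetic *)

Section BooleansAndLists.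
Context {X A : Type} `{encodable X} `{encodable A}.

Lemma polytime_negb (f : X -> bool) : polytime f -> polytime (fun x => ~~ f x).
Proof.
move=> Hf.
apply: polytime_ext (polytime_if Hf (polytime_const false) (polytime_const true)) => x.
by case: (f x).
Qed.

Lemma polytime_andb (f g : X -> bool) :
  polytime f -> polytime g -> polytime (fun x => f x && g x).
Proof. by move=> Hf Hg; apply: (polytime_if Hf Hg (polytime_const false)). Qed.

Lemma polytime_orb (f g : X -> bool) :
  polytime f -> polytime g -> polytime (fun x => f x || g x).
Proof. by move=> Hf Hg; apply: (polytime_if Hf (polytime_const true) Hg). Qed.

Lemma polytime_addb (f g : X -> bool) :
  polytime f -> polytime g -> polytime (fun x => f x (+) g x).
Proof.
move=> Hf Hg; apply: polytime_ext (polytime_if Hf (polytime_negb Hg) Hg) => x.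
by case: (f x).
Qed.

Lemma polytime_eqb (f g : X -> bool) :
  polytime f -> polytime g -> polytime (fun x => f x == g x).
Proof.
move=> Hf Hg; apply: polytime_ext (polytime_negb (polytime_addb Hf Hg)) => x.
by rewrite -negb_add.
Qed.

Lemma polytime_behead (f : X -> seq A) : polytime f -> polytime (fun x => behead (f x)).
Proof.
move=> Hf; apply: (@polytime_ext _ _ _ _ (fun x => if f x is y :: s' then s' else [::])).
  by move=> x; case: (f x).
apply: (polytime_case (g := fun _ s' _ => s')) => //; first exact: polytime_const.
by polytime_solve.
Qed.

Lemma polytime_head (d : A) (f : X -> seq A) : polytime f -> polytime (fun x => head d (f x)).
Proof.
move=> Hf; apply: (polytime_case (g := fun y _ _ => y)) => //; first exact: polytime_const.
by polytime_solve.
Qed.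

Lemma polytime_nilp (f : X -> seq A) : polytime f -> polytime (fun x => nilp (f x)).
Proof.
move=> Hf; apply: (@polytime_ext _ _ _ _ (fun x => if f x is y :: s' then false else true)).
  by move=> x; case: (f x).
by apply: (polytime_case (g := fun _ _ _ => false)) => //; exact: polytime_const.
Qed.

Lemma polytime_rev (f : X -> seq A) : polytime f -> polytime (fun x => rev (f x)).
Proof.
move=> Hf; apply: (@polytime_ext _ _ _ _ (fun x => foldl (fun s y => y :: s) [::] (f x))).
  move=> x; rewrite -[f x]revK foldl_rev revK.
  by elim: (rev (f x)) => //= y s ->.
apply: (@polytime_foldl_additive _ _ _ _ _ _ 1 _ _ (fun _ s y => y :: s)) => //;
  polytime_solve.
by move=> x s y; rewrite esize_cons; lia.
Qed.

End BooleansAndLists.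

Section RightFolds.
Context {X A B : Type} `{encodable X} `{encodable A} `{encodable B}.

Lemma polytime_foldr_measure (mu : B -> nat) c k l
  (s : X -> seq A) (z : X -> B) (g : X -> A -> B -> B) :
  polytime s -> polytime z ->
  polytime (fun p : X * (B * A) => g p.1 p.2.2 p.2.1) ->
  (forall b, esize b <= c * mu b + c) -> (forall x, mu (z x) <= (esize x + 2) ^ l) ->
  (forall x a b, mu (g x a b) <= mu b + (esize x + esize a + 2) ^ k) ->
  polytime (fun x => foldr (g x) (z x) (s x)).
Proof.
move=> Hs Hz Hg Hc Hl Hk.
apply: (@polytime_ext _ _ _ _ (fun x => foldl (fun b a => g x a b) (z x) (rev (s x)))).
  by move=> x; rewrite foldl_rev.
apply: (@polytime_foldl_measure _ _ _ _ _ _ mu c k l _ _ (fun x b a => g x a b)) => //.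
exact: polytime_rev.
Qed.

Lemma polytime_foldr k (s : X -> seq A) (z : X -> B) (g : X -> A -> B -> B) :
  polytime s -> polytime z ->
  polytime (fun p : X * (B * A) => g p.1 p.2.2 p.2.1) ->
  (forall x a b, esize (g x a b) <= esize b + (esize x + esize a + 2) ^ k) ->
  polytime (fun x => foldr (g x) (z x) (s x)).
Proof.
move=> Hs Hz Hg Hk; have [l Hl] := polytime_esize Hz.
by apply: (@polytime_foldr_measure esize 1 k l) => // b; rewrite mul1n leq_addr.
Qed.

End RightFolds.

Section MapAndQuantifiers.
Context {X A B : Type} `{encodable X} `{encodable A} `{encodable B}.

Lemma polytime_map (s : X -> seq A) (f : X -> A -> B) :
  polytime s -> polytime (fun p : X * A => f p.1 p.2) ->
  polytime (fun x => [seq f x a | a <- s x]).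
Proof.
move=> Hs Hf; have [k Hk] := polytime_esize Hf.
have [m Hm] : polyb (fun n => (n + 1 + 2) ^ k + 1) by polyb_solve.
apply: (@polytime_foldr _ _ _ _ _ _ m _ _ (fun x a t => f x a :: t)) => //.
- exact: polytime_const.
- apply: polytime_cons; polytime_solve.
  by apply: (polytime_comp2 (h := f)) => //; polytime_solve.
move=> x a t; rewrite esize_cons -addSn addnC leq_add2l.
apply: leq_trans (Hm _); rewrite addn1 ltnS.
by have := Hk (x, a); rewrite esize_pair addn1.
Qed.

Lemma polytime_all (s : X -> seq A) (f : X -> A -> bool) :
  polytime s -> polytime (fun p : X * A => f p.1 p.2) ->
  polytime (fun x => all (f x) (s x)).
Proof.
move=> Hs Hf.
apply: (@polytime_ext _ _ _ _ (fun x => foldr (fun a b => f x a && b) true (s x))).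
  by move=> x; elim: (s x) => //= a t ->.
apply: (@polytime_foldr _ _ _ _ _ _ 2 _ _ (fun x a b => f x a && b)) => //.
- exact: polytime_const.
- apply: polytime_andb; polytime_solve.
  by apply: (polytime_comp2 (h := f)) => //; polytime_solve.
move=> x a b; apply: leq_trans (leq_addl _ _); apply: leq_trans (esize_bool _) _.
by rewrite -mulnn; nia.
Qed.

Lemma polytime_has (s : X -> seq A) (f : X -> A -> bool) :
  polytime s -> polytime (fun p : X * A => f p.1 p.2) ->
  polytime (fun x => has (f x) (s x)).
Proof.
move=> Hs Hf.
apply: (@polytime_ext _ _ _ _ (fun x => ~~ all (fun a => ~~ f x a) (s x))).
  by move=> x; elim: (s x) => //= a t <-; rewrite negb_and negbK.
apply/polytime_negb/(@polytime_all _ (fun x a => ~~ f x a)) => //.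
by apply: polytime_negb.
Qed.

End MapAndQuantifiers.

Section Lengths.
Context {X A : Type} `{encodable X} `{encodable A}.

(** In unary, the length of a list is the list itself with every element replaced by [tt]. *)
Lemma polytime_size (s : X -> seq A) : polytime s -> polytime (fun x => size (s x)).
Proof.
move=> Hs; apply: (@polytime_recode _ _ _ _ _ _ (fun x => [seq tt | a <- s x])).
  by move=> x; rewrite /to_tree /encodable_nat; congr to_tree; elim: (s x) => //= a t ->.
by apply: (polytime_map Hs (f := fun _ _ => tt)); apply: polytime_const.
Qed.

End Lengths.

Section UnaryNumbers.
Context {X : Type} `{encodable X}.

Lemma polytime_units (n : X -> nat) : polytime n -> polytime (fun x => nseq (n x) tt).
Proof. exact: polytime_recode. Qed.

End UnaryNumbers.

Section RandomAccess.
Context {X A : Type} `{encodable X} `{encodable A}.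

Lemma polytime_drop (n : X -> nat) (s : X -> seq A) :
  polytime n -> polytime s -> polytime (fun x => drop (n x) (s x)).
Proof.
move=> Hn Hs.
apply: (@polytime_ext _ _ _ _ (fun x => foldl (fun t _ => behead t) (s x) (nseq (n x) tt))).
  move=> x; elim: (n x) (s x) => [|m IH] [|a t] //=; rewrite IH // drop_nil.
apply: (@polytime_foldl_additive _ _ _ _ _ _ 1 _ _ (fun _ t _ => behead t)) => //.
  by apply: polytime_behead; polytime_solve.
by move=> x [|a t] b //=; rewrite ?esize_cons; lia.
Qed.

Lemma polytime_nth (d : A) (s : X -> seq A) (n : X -> nat) :
  polytime s -> polytime n -> polytime (fun x => nth d (s x) (n x)).
Proof.
move=> Hs Hn; apply: polytime_ext (polytime_head d (polytime_drop Hn Hs)) => x.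
by rewrite -nth0 nth_drop addn0.
Qed.

Lemma polytime_cat (s t : X -> seq A) :
  polytime s -> polytime t -> polytime (fun x => s x ++ t x).
Proof.
move=> Hs Ht; apply: (@polytime_ext _ _ _ _ (fun x => foldr (fun a u => a :: u) (t x) (s x))).
  by move=> x; elim: (s x) => //= a u ->.
apply: (polytime_ext (f := fun x => foldl (fun u a => a :: u) (t x) (rev (s x)))).
  by move=> x; rewrite foldl_rev.
apply: (@polytime_foldl_additive _ _ _ _ _ _ 1 _ _ (fun _ u a => a :: u)) => //.
- exact: polytime_rev.
- by polytime_solve.
by move=> x u a; rewrite esize_cons; lia.
Qed.

End RandomAccess.

Section UnaryArithmetic.
Context {X : Type} `{encodable X}.

Lemma polytime_addn (m n : X -> nat) :
  polytime m -> polytime n -> polytime (fun x => m x + n x).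
Proof.
move=> Hm Hn.
have Hs := polytime_size (polytime_cat (polytime_units Hm) (polytime_units Hn)).
apply: polytime_ext Hs => x.
by rewrite size_cat !size_nseq.
Qed.

Lemma polytime_subn (m n : X -> nat) :
  polytime m -> polytime n -> polytime (fun x => m x - n x).
Proof.
move=> Hm Hn; apply: polytime_ext (polytime_size (polytime_drop Hn (polytime_units Hm))).
by move=> x; rewrite size_drop size_nseq.
Qed.

Lemma polytime_maxn (m n : X -> nat) :
  polytime m -> polytime n -> polytime (fun x => maxn (m x) (n x)).
Proof.
move=> Hm Hn; apply: polytime_ext (polytime_addn Hm (polytime_subn Hn Hm)) => x.
by rewrite maxnE.
Qed.

Lemma iota_last n : iota 0 n.+1 = iota 0 n ++ [:: n].
Proof. by rewrite -addn1 iotaD. Qed.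

Lemma esize_iota n : esize (iota 0 n) <= n * (2 * n + 2) + 1.
Proof.
elim: n => // n IH; rewrite iota_last esize_cat esize_cons esize_nil esize_nat.
by apply: leq_trans (_ : n * (2 * n + 2) + 1 + (n.*2.+1 + 1).+1 <= _); lia.
Qed.

Lemma foldl_iota (s : seq unit) :
  foldl (fun b _ => size b :: b) [::] s = rev (iota 0 (size s)).
Proof.
elim/last_ind: s => // s t IH.
by rewrite -cats1 foldl_cat size_cat addn1 iota_last rev_cat IH /= size_rev size_iota.
Qed.

Lemma polytime_iota (n : X -> nat) : polytime n -> polytime (fun x => iota 0 (n x)).
Proof.
move=> Hn; have [k Hk] := polytime_esize Hn.
apply: (@polytime_ext _ _ _ _
  (fun x => rev (foldl (fun b _ => size b :: b) [::] (nseq (n x) tt)))).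
  by move=> x; rewrite foldl_iota revK size_nseq.
apply: polytime_rev.
(* Each round adds a unary number that grows with the accumulator, so the additive rule does not
   apply. Instead, every intermediate value is itself a reversed [iota], of quadratic size. *)
apply: (@polytime_foldl _ _ _ _ _ _ _ _ (fun _ b _ => size b :: b)
  (fun n => (n + 2) ^ k * (2 * (n + 2) ^ k + 2) + 1)) => //.
- exact: polytime_const.
- by apply: polytime_cons; [apply: polytime_size|]; polytime_solve.
- by polyb_solve.
move=> x i; rewrite foldl_iota esize_rev.
apply: leq_trans (esize_iota _) _; rewrite leq_add2r.
have nk : size (take i (nseq (n x) tt)) <= (esize x + 2) ^ k.
  apply: leq_trans (Hk x); rewrite esize_nat size_take size_nseq.
  by case: ifP; lia.
by apply: leq_mul => //; rewrite leq_add2r leq_mul2l.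
Qed.

(** The constant [k] is built into the program, with one nested case analysis per unit. *)
Lemma polytime_eqn_const k (n : X -> nat) : polytime n -> polytime (fun x => n x == k).
Proof.
move=> Hn; have E : polytime (fun s : seq unit => size s == k); last first.
  apply: polytime_ext (polytime_comp E (polytime_units Hn)) => x.
  by rewrite size_nseq.
elim: k => [|k IH].
  by apply: (polytime_nilp (f := id)); apply: polytime_id.
apply: (@polytime_ext _ _ _ _ (fun s => if s is y :: s' then size s' == k else false)).
  by case.
apply: (polytime_case (g := fun _ s' _ => size s' == k)).
- exact: polytime_id.
- exact: polytime_const.
by apply: (polytime_comp IH); polytime_solve.
Qed.

End UnaryArithmetic.

Definition symbol_index (s : symbol) : nat :=
  match s with
  | Bit false => 0 | Bit true => 1 | Minus => 2 | Slash => 3 | Comma => 4 | Semicolon => 5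
  end.

#[global] Instance encodable_symbol : encodable symbol := fun s => to_tree (symbol_index s).

Lemma polytime_eq_symbol X `{encodable X} (c : symbol) (f : X -> symbol) :
  polytime f -> polytime (fun x => f x == c).
Proof.
move=> Hf; apply: (@polytime_ext _ _ _ _ (fun x => symbol_index (f x) == symbol_index c)).
  by move=> x; case: c (f x) => [[]||||] [[]||||].
by apply: polytime_eqn_const; apply: polytime_recode Hf.
Qed.

Ltac polytime_extra ::=
  match goal with
  | |- polytime (fun x => ~~ _) => apply: polytime_negb
  | |- polytime (fun x => _ && _) => apply: polytime_andb
  | |- polytime (fun x => _ || _) => apply: polytime_orb
  | |- polytime (fun x => _ (+) _) => apply: polytime_addb
  | |- polytime (fun x => @eq_op _ _ _) =>
      first [apply: polytime_eq_symbol | apply: polytime_eqb]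
  | |- polytime (fun x => behead _) => apply: polytime_behead
  | |- polytime (fun x => head _ _) => apply: polytime_head
  | |- polytime (fun x => nilp _) => apply: polytime_nilp
  | |- polytime (fun x => rev _) => apply: polytime_rev
  | |- polytime (fun x => map _ _) => apply: polytime_map
  | |- polytime (fun x => all _ _) => apply: polytime_all
  | |- polytime (fun x => has _ _) => apply: polytime_has
  | |- polytime (fun x => size _) => apply: polytime_size
  | |- polytime (fun x => nth _ _ _) => apply: polytime_nth
  | |- polytime (fun x => maxn _ _) => apply: polytime_maxn
  | |- polytime (fun x => iota 0 _) => apply: polytime_iota
  end.

(** * Binary arithmetic, fractions and the decision procedures *)

Lemma polytime_comp4 A B C D E F `{encodable A} `{encodable B} `{encodable C}
  `{encodable D} `{encodable E} `{encodable F}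
  (h : B -> C -> D -> E -> F) (f : A -> B) (g : A -> C) (k : A -> D) (l : A -> E) :
  polytime (fun p => h p.1.1.1 p.1.1.2 p.1.2 p.2) -> polytime f -> polytime g ->
  polytime k -> polytime l -> polytime (fun x => h (f x) (g x) (k x) (l x)).
Proof.
move=> Hh Hf Hg Hk Hl.
by apply: (polytime_comp Hh (polytime_pair (polytime_pair (polytime_pair Hf Hg) Hk) Hl)).
Qed.

Notation bitstring := (seq bool).

(** A full adder: [st.1] is the carry and [st.2] the output, newest bit first. The default [false]
    pads the shorter summand with zeros. *)
Definition add_step (u v : bitstring) (st : bool * bitstring) (i : nat) : bool * bitstring :=
  ((nth false u i && nth false v i) || (st.1 && (nth false u i (+) nth false v i)),
   (nth false u i (+) nth false v i (+) st.1) :: st.2).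

Definition add_state (u v : bitstring) (n : nat) : bool * bitstring :=
  foldl (add_step u v) (false, [::]) (iota 0 n).

Definition add_bits (u v : bitstring) : bitstring :=
  rev ((add_state u v (maxn (size u) (size v))).1 ::
       (add_state u v (maxn (size u) (size v))).2).

(** Positions are read from the least significant one upwards, so the last position at which the
    numbers differ decides. *)
Definition leq_state (u v : bitstring) (n : nat) : bool :=
  foldl (fun r i => if nth false u i == nth false v i then r else nth false v i)
        true (iota 0 n).

Definition leq_bits (u v : bitstring) : bool := leq_state u v (maxn (size u) (size v)).

(** Horner's rule on the digits of [v], most significant first; [false :: acc] doubles the
    accumulator. *)
Definition mul_bits (u v : bitstring) : bitstring :=
  foldr (fun b acc => add_bits (false :: acc) (if b then u else [::])) [::] v.

Lemma size_add_state u v n : size (add_state u v n).2 = n.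
Proof.
rewrite /add_state; elim: n => // n IH.
by rewrite iota_last foldl_cat /= IH.
Qed.

Lemma size_add_bits u v : size (add_bits u v) = (maxn (size u) (size v)).+1.
Proof. by rewrite size_rev /= size_add_state. Qed.

(** The two factors enter differently: each digit of [v] causes one round, and a round lengthens the
    result by a shift and a carry. *)
Lemma size_mul_bits u v : size (mul_bits u v) <= size u + 2 * size v.
Proof.
elim: v => // b v IH; rewrite /= size_add_bits /=.
by case: b; move: (size (mul_bits u v)) IH => n /=; lia.
Qed.

Lemma esize_bits (u : bitstring) : esize u <= 4 * size u + 4.
Proof. by elim: u => // b u IH; rewrite esize_cons; have := esize_bool b; move: IH => /=; lia. Qed.

Lemma size_bits_esize (u : bitstring) : size u < esize u.
Proof. exact: size_esize. Qed.

Lemma polytime_add_state X `{encodable X} (f g : X -> bitstring) (n : X -> nat) :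
  polytime f -> polytime g -> polytime n ->
  polytime (fun x => add_state (f x) (g x) (n x)).
Proof.
move=> Hf Hg Hn.
have E : polytime (fun p : bitstring * bitstring * nat => add_state p.1.1 p.1.2 p.2).
  apply: (@polytime_foldl_additive _ _ _ _ _ _ 3 (fun p : bitstring * bitstring * nat => iota 0 p.2)
    (fun=> (false, [::])) (fun p => add_step p.1.1 p.1.2)).
  - by polytime_solve.
  - by polytime_solve.
  - by rewrite /add_step; polytime_solve.
  move=> p st i; rewrite !esize_pair /= esize_cons.
  set b1 := (X in esize X + _); set b2 := (X in _ + (esize X + _).+1 < _).
  have := esize_bool b1; have := esize_bool b2; rewrite !expnS; nia.
by apply: (polytime_comp3 E).
Qed.

Lemma polytime_add_bits X `{encodable X} (f g : X -> bitstring) :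
  polytime f -> polytime g -> polytime (fun x => add_bits (f x) (g x)).
Proof.
move=> Hf Hg; rewrite /add_bits; polytime_solve; apply: polytime_add_state => //;
  by polytime_solve.
Qed.

Lemma polytime_leq_bits X `{encodable X} (f g : X -> bitstring) :
  polytime f -> polytime g -> polytime (fun x => leq_bits (f x) (g x)).
Proof.
move=> Hf Hg; apply: (polytime_comp2 (h := leq_bits)) => //.
apply: (@polytime_foldl_additive _ _ _ _ _ _ 2
  (fun p : bitstring * bitstring => iota 0 (maxn (size p.1) (size p.2))) (fun=> true)
  (fun p r i => if nth false p.1 i == nth false p.2 i then r else nth false p.2 i)).
- by polytime_solve.
- by polytime_solve.
- by polytime_solve.
move=> p r i; apply: leq_trans (esize_bool _) _; rewrite -mulnn; nia.
Qed.

Lemma polytime_mul_bits X `{encodable X} (f g : X -> bitstring) :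
  polytime f -> polytime g -> polytime (fun x => mul_bits (f x) (g x)).
Proof.
move=> Hf Hg; apply: (polytime_comp2 (h := mul_bits)) => //.
apply: (@polytime_foldr_measure _ _ _ _ _ _ (fun u => size u) 4 1 1
  (fun p : bitstring * bitstring => p.2) (fun=> [::])
  (fun p b acc => add_bits (false :: acc) (if b then p.1 else [::]))).
- by polytime_solve.
- by polytime_solve.
- by apply: polytime_add_bits; polytime_solve.
- exact: esize_bits.
- by [].
move=> [u v] b acc; rewrite size_add_bits esize_pair /= expn1.
have := size_bits_esize u; case: b => /=; lia.
Qed.

(* ((a, b), d) stands for the fraction (a - b) / d, which avoids signs. *)
Notation frac := (bitstring * bitstring * bitstring)%type.

Definition zero_frac : frac := ([::], [::], [:: true]).

(** The parts of [x], the running sum in [fiber_sum], come first in every product, since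
    [size_mul_bits] counts the first factor only once. *)
Definition add_frac (x y : frac) : frac :=
  (add_bits (mul_bits x.1.1 y.2) (mul_bits x.2 y.1.1),
   add_bits (mul_bits x.1.2 y.2) (mul_bits x.2 y.1.2),
   mul_bits x.2 y.2).

Definition mul_frac (x y : frac) : frac :=
  (add_bits (mul_bits x.1.1 y.1.1) (mul_bits x.1.2 y.1.2),
   add_bits (mul_bits x.1.1 y.1.2) (mul_bits x.1.2 y.1.1),
   mul_bits x.2 y.2).

(** Cross-multiplication, with the negative parts moved to the opposite sides so that only natural
    numbers are compared. *)
Definition leq_frac (x y : frac) : bool :=
  leq_bits (add_bits (mul_bits x.1.1 y.2) (mul_bits y.1.2 x.2))
           (add_bits (mul_bits y.1.1 x.2) (mul_bits x.1.2 y.2)).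

Definition frac_width (x : frac) : nat :=
  maxn (maxn (size x.1.1) (size x.1.2)) (size x.2).

(** The coefficient 1 of [frac_width x] is what matters: with a larger one, the bound would grow
    exponentially with the number of summands. *)
Lemma frac_width_add x y : frac_width (add_frac x y) <= frac_width x + 2 * frac_width y + 1.
Proof.
rewrite /frac_width /= !size_add_bits.
have := size_mul_bits x.1.1 y.2; have := size_mul_bits x.2 y.1.1.
have := size_mul_bits x.1.2 y.2; have := size_mul_bits x.2 y.1.2.
have := size_mul_bits x.2 y.2; lia.
Qed.

Lemma frac_width_esize x : frac_width x <= esize x.
Proof.
rewrite /frac_width !esize_pair.
have := size_bits_esize x.1.1; have := size_bits_esize x.1.2; have := size_bits_esize x.2; lia.
Qed.

Lemma esize_frac_width x : esize x <= 12 * frac_width x + 14.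
Proof.
rewrite /frac_width !esize_pair.
have := esize_bits x.1.1; have := esize_bits x.1.2; have := esize_bits x.2; lia.
Qed.

Ltac polytime_bits :=
  repeat first [ apply: polytime_add_bits | apply: polytime_mul_bits | polytime_step ].

Lemma polytime_add_frac X `{encodable X} (f g : X -> frac) :
  polytime f -> polytime g -> polytime (fun x => add_frac (f x) (g x)).
Proof. by move=> Hf Hg; rewrite /add_frac; polytime_bits. Qed.

Lemma polytime_mul_frac X `{encodable X} (f g : X -> frac) :
  polytime f -> polytime g -> polytime (fun x => mul_frac (f x) (g x)).
Proof. by move=> Hf Hg; rewrite /mul_frac; polytime_bits. Qed.

Lemma polytime_leq_frac X `{encodable X} (f g : X -> frac) :
  polytime f -> polytime g -> polytime (fun x => leq_frac (f x) (g x)).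
Proof. by move=> Hf Hg; apply: polytime_leq_bits; polytime_bits. Qed.

(** * Tests on the parsed table *)

Notation table_row := (seq bitstring * (frac * seq frac))%type.

Definition agree (m : bitstring) (r s : table_row) : bool :=
  all (fun i => ~~ nth false m i ||
         (leq_bits (nth [::] r.1 i) (nth [::] s.1 i) &&
          leq_bits (nth [::] s.1 i) (nth [::] r.1 i))) (iota 0 (size m)).

Definition fiber_sum (m : bitstring) (rows : seq table_row) (s : table_row) (i : nat) : frac :=
  foldl (fun acc r => if agree m r s
                      then add_frac acc (mul_frac r.2.1 (nth zero_frac r.2.2 i))
                      else acc) zero_frac rows.

Definition row_ok (m : bitstring) (rows : seq table_row) (s : table_row) : bool :=
  all (fun i =>
    all (fun j => leq_frac (nth zero_frac s.2.2 j) (nth zero_frac s.2.2 i))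
        (iota 0 (size s.2.2)) ==
    all (fun j => leq_frac (fiber_sum m rows s j) (fiber_sum m rows s i))
        (iota 0 (size s.2.2)))
  (iota 0 (size s.2.2)).

Definition anchor_test (m : bitstring) (rows : seq table_row) : bool :=
  has (fun t => all (fun s => ~~ agree m s t || row_ok m rows s) rows) rows.

(** The candidate set attached to the state [t]; [leq_bits c [::]] recognizes rank 0. *)
Definition nonzero_mask (t : table_row) : bitstring := [seq ~~ leq_bits c [::] | c <- t.1].

Definition weight (m : bitstring) : bitstring :=
  foldl (fun acc b => if b then add_bits acc [:: true] else acc) [::] m.

Definition minimum_test (k : bitstring) (rows : seq table_row) : bool :=
  has (fun t => leq_bits (weight (nonzero_mask t)) k &&
                all (row_ok (nonzero_mask t) rows) rows) rows.

Lemma polytime_agree X `{encodable X} (m : X -> bitstring) (r s : X -> table_row) :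
  polytime m -> polytime r -> polytime s -> polytime (fun x => agree (m x) (r x) (s x)).
Proof.
move=> Hm Hr Hs; apply: (polytime_comp3 (h := agree)) => //; rewrite /agree.
by repeat first [ apply: polytime_leq_bits | polytime_step ].
Qed.

Lemma polytime_fiber_sum X `{encodable X} (m : X -> bitstring) rows s (i : X -> nat) :
  polytime m -> polytime rows -> polytime s -> polytime i ->
  polytime (fun x => fiber_sum (m x) (rows x) (s x) (i x)).
Proof.
move=> Hm Hrows Hs Hi; apply: (polytime_comp4 (h := fiber_sum)) => //.
pose Y := (bitstring * seq table_row * table_row * nat)%type.
have Hterm : polytime (fun p : Y * table_row =>
    mul_frac p.2.2.1 (nth zero_frac p.2.2.2 p.1.2)).
  by apply: polytime_mul_frac; polytime_solve.
have [k Hk] := polytime_esize Hterm.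
(* By [frac_width_add] a round widens the sum by twice the width of the new term plus 1, and the
   term has size polynomial in that of [(p, r)]. The [14] below comes from [esize_frac_width]. *)
have [l Hl] : polyb (fun n => 2 * (n + 1 + 2) ^ k + 1) by polyb_solve.
apply: (@polytime_foldl_measure _ _ _ _ _ _ frac_width 14 l 0
  (fun p : Y => p.1.1.2) (fun=> zero_frac)
  (fun p acc r => if agree p.1.1.1 r p.1.2
                  then add_frac acc (mul_frac r.2.1 (nth zero_frac r.2.2 p.2)) else acc)).
- by polytime_solve.
- by polytime_solve.
- apply: polytime_if; [apply: polytime_agree|apply: polytime_add_frac|]; polytime_solve.
  by apply: polytime_mul_frac; polytime_solve.
- by move=> b; apply: leq_trans (esize_frac_width _) _; lia.
- by [].
move=> p acc r; case: ifP => _; last exact: leq_addr.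
apply: leq_trans (frac_width_add _ _) _; rewrite -addnA leq_add2l.
apply: leq_trans (Hl _); rewrite leq_add2r leq_mul2l /=.
apply: leq_trans (frac_width_esize _) _.
have <- : esize (p, r) = esize p + esize r + 1 by rewrite addn1; apply: esize_pair.
exact: (Hk (p, r)).
Qed.

Lemma polytime_row_ok X `{encodable X} (m : X -> bitstring) rows s :
  polytime m -> polytime rows -> polytime s ->
  polytime (fun x => row_ok (m x) (rows x) (s x)).
Proof.
move=> Hm Hrows Hs; apply: (polytime_comp3 (h := row_ok)) => //; rewrite /row_ok.
by repeat first [ apply: polytime_leq_frac | apply: polytime_fiber_sum | polytime_step ].
Qed.

Lemma polytime_anchor_test X `{encodable X} (m : X -> bitstring) rows :
  polytime m -> polytime rows -> polytime (fun x => anchor_test (m x) (rows x)).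
Proof.
move=> Hm Hrows; apply: (polytime_comp2 (h := anchor_test)) => //; rewrite /anchor_test.
by repeat first [ apply: polytime_agree | apply: polytime_row_ok | polytime_step ].
Qed.

Lemma polytime_nonzero_mask X `{encodable X} (t : X -> table_row) :
  polytime t -> polytime (fun x => nonzero_mask (t x)).
Proof.
move=> Ht; rewrite /nonzero_mask.
by repeat first [ apply: polytime_leq_bits | polytime_step ].
Qed.

Lemma polytime_weight X `{encodable X} (m : X -> bitstring) :
  polytime m -> polytime (fun x => weight (m x)).
Proof.
move=> Hm; apply: (polytime_comp (g := weight)) => //.
apply: (@polytime_foldl_measure _ _ _ _ _ _ (fun u => size u) 4 1 0
  (fun m : bitstring => m) (fun=> [::])
  (fun _ acc b => if b then add_bits acc [:: true] else acc)).
- by polytime_solve.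
- by polytime_solve.
- by apply: polytime_if; [|apply: polytime_add_bits|]; polytime_solve.
- exact: esize_bits.
- by [].
move=> u acc b; case: b; rewrite ?size_add_bits /=; lia.
Qed.

Lemma polytime_minimum_test X `{encodable X} (k : X -> bitstring) rows :
  polytime k -> polytime rows -> polytime (fun x => minimum_test (k x) (rows x)).
Proof.
move=> Hk Hrows; apply: (polytime_comp2 (h := minimum_test)) => //; rewrite /minimum_test.
by repeat first [ apply: polytime_leq_bits | apply: polytime_weight
  | apply: polytime_nonzero_mask | apply: polytime_row_ok | polytime_step ].
Qed.

(* The list [z] is [[::]] when the blocks are terminated by [c], and [[:: [::]]] when they
   are separated by [c]. *)
Definition split_step (c s : symbol) (bl : seq (seq symbol)) : seq (seq symbol) :=
  if s == c then [::] :: bl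
  else if nilp bl then [::] else (s :: head [::] bl) :: behead bl.

Definition split_at (c : symbol) (z : seq (seq symbol)) (w : seq symbol) :=
  foldr (split_step c) z w.

Definition to_bits (w : seq symbol) : bitstring := [seq s == Bit true | s <- w].

Definition parse_frac (w : seq symbol) : frac :=
  let bl := split_at Slash [:: [::]] w in
  if head Semicolon (head [::] bl) == Minus
  then ([::], to_bits (behead (head [::] bl)), to_bits (head [::] (behead bl)))
  else (to_bits (head [::] bl), [::], to_bits (head [::] (behead bl))).

(** Blocks arrive from the right. At most two are pending in [st.1], and a third one completes a
    row. *)
Definition group_step (b : seq symbol) (st : seq (seq symbol) * seq (seq (seq symbol))) :=
  if nilp (behead st.1) then (b :: st.1, st.2) else ([::], (b :: st.1) :: st.2).

Definition group3 (bl : seq (seq symbol)) : seq (seq (seq symbol)) :=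
  (foldr group_step ([::], [::]) bl).2.

Definition parse_row (r : seq (seq symbol)) : table_row :=
  ([seq to_bits c | c <- split_at Comma [::] (nth [::] r 0)],
   (parse_frac (nth [::] r 1),
    [seq parse_frac u | u <- split_at Comma [::] (nth [::] r 2)])).

(** The header, a bound or a subset depending on the problem, is a string of bits in both cases, so
    one parser serves both. *)
Definition parse (w : seq symbol) : bitstring * seq table_row :=
  let bl := split_at Semicolon [::] w in
  (to_bits (head [::] bl), [seq parse_row r | r <- group3 (behead bl)]).

Lemma polytime_split_at X `{encodable X} c z (f : X -> seq symbol) :
  polytime f -> polytime (fun x => split_at c z (f x)).
Proof.
move=> Hf; apply: (polytime_comp (g := split_at c z)) => //.
apply: (@polytime_foldr _ _ _ _ _ _ 1 (fun w : seq symbol => w) (fun=> z) (fun _ => split_step c)).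
- by polytime_solve.
- by polytime_solve.
- by rewrite /split_step; polytime_solve.
move=> x s bl; rewrite /split_step expn1; case: ifP => _.
  by rewrite esize_cons esize_nil; lia.
by case: bl => [|b bl] /=; rewrite ?esize_nil ?esize_cons; lia.
Qed.

Lemma polytime_to_bits X `{encodable X} (f : X -> seq symbol) :
  polytime f -> polytime (fun x => to_bits (f x)).
Proof. by move=> Hf; rewrite /to_bits; polytime_solve. Qed.

Lemma polytime_parse_frac X `{encodable X} (f : X -> seq symbol) :
  polytime f -> polytime (fun x => parse_frac (f x)).
Proof.
move=> Hf; rewrite /parse_frac /=.
by repeat first [ apply: polytime_to_bits | apply: polytime_split_at | polytime_step ].
Qed.

Lemma polytime_group3 X `{encodable X} (f : X -> seq (seq symbol)) :
  polytime f -> polytime (fun x => group3 (f x)).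
Proof.
move=> Hf; apply/polytime_snd/(polytime_comp (g := foldr group_step ([::], [::]))) => //.
apply: (@polytime_foldr _ _ _ _ _ _ 2 (fun w : seq (seq symbol) => w) (fun=> ([::], [::]))
  (fun _ => group_step)).
- by polytime_solve.
- by polytime_solve.
- by rewrite /group_step; polytime_solve.
move=> x b st; rewrite /group_step expnS expn1; case: ifP => _;
  rewrite !esize_pair /= !esize_cons ?esize_nil; nia.
Qed.

Lemma polytime_parse_row X `{encodable X} (f : X -> seq (seq symbol)) :
  polytime f -> polytime (fun x => parse_row (f x)).
Proof.
move=> Hf; rewrite /parse_row.
by repeat first [ apply: polytime_to_bits | apply: polytime_parse_frac
  | apply: polytime_split_at | polytime_step ].
Qed.

Lemma polytime_parse : polytime parse.
Proof.
rewrite /parse /=.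
by repeat first [ apply: polytime_to_bits | apply: polytime_parse_row
  | apply: polytime_group3 | apply: polytime_split_at | polytime_step ].
Qed.

(** * Turning the input word into a tree *)

Definition dispatch r (f : symbol -> prog) : seq symbol -> prog :=
  foldr (fun x p => If r (pred1 (Some (inl x))) (Seq (Pop r) (f x)) p) Skip.

Lemma runs_dispatch r f l s n s' x w : x \in l -> get s r = inl x :: w ->
  runs (f x) (set s r w) n s' -> runs (dispatch r f l) s (size l + (1 + n)) s'.
Proof.
move=> xl E H; elim: l xl => // y l IH; rewrite inE.
have [<- _ | xy /= /IH {}IH] := eqVneq x y; last first.
  by apply: runs_if_false => //; rewrite /= E /=; apply: contra xy => /eqP [->].
apply: (@runs_le _ _ (1 + n).+1); first by rewrite /=; lia.
apply: runs_if_true; first by rewrite E /=.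
by apply: runs_seq H; have := runs_pop r s; rewrite E.
Qed.

Definition load_symbol : seq symbol -> prog :=
  dispatch main (fun x => Push stash (inl x)).
(** The leading [true] opens the list cell with head [x]; its tail already lies on [main]. *)
Definition load_code : seq symbol -> prog :=
  dispatch stash (fun x => push_bits (true :: bits (to_tree x))).

(** Moving the word to the stash reverses it, and consing its symbols back onto the empty list
    restores the order. *)
Definition load_input : prog :=
  Seq (While main isSome (load_symbol (enum {: symbol})))
  (Seq (Push main (letter_of false)) (While stash isSome (load_code (enum {: symbol})))).

Lemma runs_load_symbols w a :
  runs (While main isSome (load_symbol (enum {: symbol}))) (map inl w, a, [::])
    (size w * (size (enum {: symbol}) + 4) + 1) ([::], rev (map inl w) ++ a, [::]).
Proof.
elim: w a => [|x w IH] a; first exact: runs_while_false.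
rewrite rev_cons -cats1 -catA.
apply: runs_le (runs_while_true _ _ (IH _)) => //; last first.
  apply: (@runs_dispatch main _ _ _ 2 _ x (map inl w)); rewrite ?mem_enum //.
  exact: runs_push_stash.
by rewrite /= mulSn; lia.
Qed.

Lemma runs_load_codes w v :
  runs (While stash isSome (load_code (enum {: symbol})))
    (code (to_tree v), map inl w, [::])
    (size w * (size (enum {: symbol}) + 40) + 1) (code (to_tree (rev w ++ v)), [::], [::]).
Proof.
elim: w v => [|x w IH] v; first exact: runs_while_false.
rewrite rev_cons -cats1 -catA.
apply: runs_le (runs_while_true _ _ (IH _)) => //; last first.
  apply: (@runs_dispatch stash _ _ _ 37 _ x (map inl w)); rewrite ?mem_enum //.
  have -> : code (to_tree ([:: x] ++ v)) =
      map letter_of (true :: bits (to_tree x)) ++ code (to_tree v).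
    by rewrite -[LHS]cats0 code_node cats0.
  apply: runs_le (runs_push_bits _ _ _ _).
  by case: x => [[]||||].
by rewrite /= mulSn; lia.
Qed.

Lemma runs_load_input w :
  runs load_input (map inl w, [::], [::]) (size w * (2 * size (enum {: symbol}) + 44) + 4)
    (code (to_tree w), [::], [::]).
Proof.
have := runs_load_codes (rev w) [::]; rewrite revK cats0 map_rev size_rev => H.
have := runs_load_symbols w [::]; rewrite cats0 => H'.
apply: runs_le (runs_seq H' (runs_seq (runs_push_main _ _ _ _) H)); lia.
Qed.

Lemma esize_word (w : seq symbol) : esize w <= 12 * size w + 1.
Proof.
elim: w => // x w IH; rewrite esize_cons /=.
have : esize x <= 11 by case: x => [[]||||].
by move: IH => /=; lia.
Qed.

Lemma polytime_decides (Q : decision_problem symbol) (dec : seq symbol -> bool) :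
  polytime dec -> (forall x : instance Q, dec (encode x) <-> yes_instance x) ->
  polytime_decidable Q.
Proof.
move=> [p [k Hp]] Hdec.
have [m Hm] : polyb (fun n =>
    (n * (2 * size (enum {: symbol}) + 44) + 4) + (12 * n + 1 + 2) ^ k + 1).
  by polyb_solve.
(* A bound of the form [(n + 2) ^ m] translates directly into a polynomial. *)
exists (compile (Seq load_input p)), (('X + 2%:P) ^+ m)%R => x.
exists (dec (encode x)); split; first exact: Hdec.
have := Hp (encode x) [::] [::]; rewrite !cats0 => Hdx.
have [t tn ex] := runs_seq (runs_load_input (encode x)) Hdx.
rewrite (compile_answer ex) /=; first by case: (dec _).
rewrite horner_exp hornerD hornerX hornerC.
rewrite natrXE.
apply: leq_trans (Hm _); rewrite addn1 ltnS; apply: leq_trans tn _.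
rewrite leq_add2l; case: (k) => // k'; rewrite leq_exp2r // leq_add2r.
exact: esize_word.
Qed.

(** * Correctness *)

Definition bval (u : bitstring) : nat := foldr (fun (b : bool) n => b + 2 * n) 0 u.

(** The value of the lowest [n] bits, suited to induction along [iota 0 n], whereas [bval] follows
    the list. *)
Definition bsum (u : bitstring) (n : nat) : nat := \sum_(i < n) nth false u i * 2 ^ i.

Lemma bval_bsum u n : size u <= n -> bval u = bsum u n.
Proof.
elim: u n => [|b u IH] n /= un.
  by rewrite /bsum big1 // => i _; rewrite nth_nil.
case: n un => // n un; rewrite /bsum big_ord_recl /= muln1 (IH n) //; congr (_ + _).
by rewrite /bsum big_distrr /=; apply: eq_bigr => i _; rewrite /bump leq0n add1n expnS /= mulnCA.
Qed.

Lemma bsumS u n : bsum u n.+1 = bsum u n + nth false u n * 2 ^ n.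
Proof. exact: big_ord_recr. Qed.

Lemma bsum_lt u n : bsum u n < 2 ^ n.
Proof.
elim: n => [|n IH]; first by rewrite /bsum big_ord0.
by rewrite bsumS expnS; move: IH; case: (nth _ _ _); lia.
Qed.

Lemma bval_rcons u b : bval (rcons u b) = bval u + 2 ^ size u * b.
Proof. by elim: u => [|c u IH] /=; rewrite ?IH ?expnS; lia. Qed.

(** The loop invariant of the adder: output and carry together account for the bits read so far. *)
Lemma add_state_bsum u v n :
  bval (rev (add_state u v n).2) + 2 ^ n * (add_state u v n).1 = bsum u n + bsum v n.
Proof.
elim: n => [|n IH]; first by rewrite /bsum !big_ord0.
rewrite !bsumS /add_state iota_last foldl_cat -/(add_state u v n) /=.
rewrite rev_cons bval_rcons size_rev size_add_state expnS.
move: IH; case: (add_state u v n) => c o /=.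
by case: c; case: (nth _ u n); case: (nth _ v n) => /=; lia.
Qed.

Lemma bval_add u v : bval (add_bits u v) = bval u + bval v.
Proof.
rewrite /add_bits rev_cons bval_rcons size_rev size_add_state add_state_bsum.
by rewrite -!bval_bsum ?leq_maxl ?leq_maxr.
Qed.

(** All bits below position [n] are worth less than [2 ^ n], so a difference at position [n]
    outweighs them. *)
Lemma leq_state_bsum u v n : leq_state u v n = (bsum u n <= bsum v n).
Proof.
elim: n => [|n IH]; first by rewrite /bsum !big_ord0.
rewrite !bsumS /leq_state iota_last foldl_cat -/(leq_state u v n) /= IH.
have := bsum_lt u n; have := bsum_lt v n.
by case: (nth _ u n); case: (nth _ v n) => /=; lia.
Qed.

Lemma leq_bitsE u v : leq_bits u v = (bval u <= bval v).
Proof. by rewrite /leq_bits leq_state_bsum -!bval_bsum ?leq_maxl ?leq_maxr. Qed.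

Lemma bval_mul u v : bval (mul_bits u v) = bval u * bval v.
Proof.
elim: v => [|b v IH] /=; first by rewrite muln0.
by rewrite bval_add /= IH; case: b => /=; lia.
Qed.

Local Open Scope ring_scope.

Definition fval (x : frac) : rat := ((bval x.1.1)%:R - (bval x.1.2)%:R) / (bval x.2)%:R.

Lemma bval_neq0 (u : bitstring) : (0 < bval u)%N -> (bval u)%:R != 0 :> rat.
Proof. by rewrite pnatr_eq0 lt0n. Qed.

Lemma fval_add x y : (0 < bval x.2)%N -> (0 < bval y.2)%N ->
  fval (add_frac x y) = fval x + fval y.
Proof.
move=> /bval_neq0 Hx /bval_neq0 Hy.
rewrite /fval /= !bval_add !bval_mul !natrD !natrM; field.
by rewrite Hx Hy.
Qed.

Lemma fval_mul x y : (0 < bval x.2)%N -> (0 < bval y.2)%N ->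
  fval (mul_frac x y) = fval x * fval y.
Proof.
move=> /bval_neq0 Hx /bval_neq0 Hy.
rewrite /fval /= !bval_add !bval_mul !natrD !natrM; field.
by rewrite Hx Hy.
Qed.

Lemma leq_fracE x y : (0 < bval x.2)%N -> (0 < bval y.2)%N ->
  leq_frac x y = (fval x <= fval y).
Proof.
move=> Hx Hy; rewrite /leq_frac leq_bitsE !bval_add !bval_mul /fval.
rewrite ler_pdivrMr ?ltr0n // mulrAC ler_pdivlMr ?ltr0n //.
rewrite -(ler_nat rat) !natrD !natrM.
apply/idP/idP; lra.
Qed.

(** * The parser inverts the encoding *)

Lemma split_at_cat c z b w : c \notin b ->
  split_at c z (b ++ c :: w) = b :: split_at c z w.
Proof.
elim: b => [|s b IH] /=; first by rewrite /split_step eqxx.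
rewrite inE negb_or eq_sym => /andP [/negbTE sc /IH ->].
by rewrite /split_step sc.
Qed.

Lemma split_at_last c b : c \notin b -> split_at c [:: [::]] b = [:: b].
Proof.
elim: b => [|s b IH] //=; rewrite inE negb_or eq_sym => /andP [/negbTE sc /IH ->].
by rewrite /split_step sc.
Qed.

Lemma split_at_flatten c (bs : seq (seq symbol)) :
  {in bs, forall b, c \notin b} ->
  split_at c [::] (flatten [seq b ++ [:: c] | b <- bs]) = bs.
Proof.
elim: bs => //= b bs IH H; rewrite -catA split_at_cat ?H ?mem_head // IH // => b' Hb.
by apply: H; rewrite inE Hb orbT.
Qed.

Definition is_digit (s : symbol) : bool := if s is Bit _ then true else false.

Lemma encode_nat_digits n : all is_digit (encode_nat n).
Proof. by rewrite all_map; apply/allP. Qed.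

Lemma notin_encode_nat c n : ~~ is_digit c -> c \notin encode_nat n.
Proof. by apply: contra => cn; move/allP: (encode_nat_digits n) => /(_ _ cn). Qed.

Lemma to_bits_nat n : bval (to_bits (encode_nat n)) = n.
Proof.
(* The lowest [m] digits determine [k] modulo [2 ^ m]; the number of digits written by [encode_nat]
   loses nothing, also for 0. *)
have E m k : bval [seq odd (k %/ 2 ^ i) | i <- iota 0 m] = (k %% 2 ^ m)%N.
  elim: m k => [|m IH] k /=; first by rewrite modn1.
  rewrite -[1%N]addn0 iotaDl -map_comp expn0 divn1.
  rewrite (eq_map (g := fun i => odd ((k %/ 2) %/ 2 ^ i))) ?IH; last first.
    by move=> i /=; rewrite add1n expnS divnMA.
  have lt1 : (k %/ 2 %% 2 ^ m < 2 ^ m)%N by rewrite ltn_mod expn_gt0.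
  have lt2 : (k %% 2 < 2)%N by rewrite ltn_mod.
  have ek : k = (k %/ 2 %/ 2 ^ m * 2 ^ m.+1 + (k %/ 2 %% 2 ^ m * 2 + k %% 2))%N.
    rewrite {1}(divn_eq k 2) {1}(divn_eq (k %/ 2) (2 ^ m)) mulnDl addnA.
    by rewrite expnSr mulnA.
  rewrite -modn2 {3}ek modnMDl [RHS]modn_small ?expnSr.
    by lia.
  by lia.
rewrite /to_bits /encode_nat -map_comp (eq_map (g := fun i => odd (n %/ 2 ^ i))).
  rewrite E modn_small //.
  by have [|n0] := posnP n; [move=> -> | apply: trunc_log_ltn].
by move=> i /=; case: odd.
Qed.

Lemma encode_rat_notin c q : ~~ is_digit c -> c != Minus -> c != Slash ->
  c \notin encode_rat q.
Proof.
move=> cd cm cs; rewrite /encode_rat -[Slash :: _]cat1s !mem_cat !(negbTE (notin_encode_nat _ cd)).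
by rewrite mem_seq1 (negbTE cs) !orbF; case: ifP; rewrite // mem_seq1.
Qed.

Lemma parse_frac_encode q :
  fval (parse_frac (encode_rat q)) = q /\ (0 < bval (parse_frac (encode_rat q)).2)%N.
Proof.
rewrite /parse_frac /encode_rat catA split_at_cat ?split_at_last ?notin_encode_nat //; last first.
  by rewrite mem_cat (negbTE (notin_encode_nat _ _)) // orbF; case: ifP.
have Hd : (`|denq q|%:R : rat) = (denq q)%:~R.
  by rewrite pmulrn gez0_abs // denq_ge0.
(* Even 0 is written with one digit, so the head is a [Bit] by computation. *)
have Hm n : head Semicolon (encode_nat n) != Minus by [].
case: (ltrP q 0) => q0; cbn [cat head behead].
  rewrite eqxx /fval; cbn [fst snd]; rewrite !to_bits_nat absz_gt0 denq_neq0; split=> //.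
  rewrite Hd -[RHS]divq_num_den; congr (_ / _).
  by rewrite (pmulrn _ `|numq q|%N) ltz0_abs ?numq_lt0 // mulr0n sub0r mulrNz opprK.
rewrite (negbTE (Hm _)) /fval; cbn [fst snd].
rewrite !to_bits_nat absz_gt0 denq_neq0; split=> //.
rewrite Hd -[RHS]divq_num_den; congr (_ / _).
by rewrite (pmulrn _ `|numq q|%N) gez0_abs ?numq_ge0 // subr0.
Qed.

(** * The tests agree with the definitions *)

Section Problem.
Variable D : stoch_problem.

Local Notation state := (Defs.state D).
Implicit Types (s r t : state) (I : {set 'I_(dim D)}).

Definition coord_field s : seq symbol :=
  flatten [seq b ++ [:: Comma] | b <- [seq encode_nat (enum_rank (s i)) | i <- enum 'I_(dim D)]].

Definition utility_field s : seq symbol :=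
  flatten [seq b ++ [:: Comma] | b <- [seq encode_rat (utility a s) | a <- enum (action D)]].

Definition fields s : seq (seq symbol) :=
  [:: coord_field s; encode_rat (prob s); utility_field s].

Definition row_of s : table_row := parse_row (fields s).

Arguments row_of : simpl never.

Definition rows : seq table_row := [seq row_of s | s <- enum state].

Lemma encode_row_fields s :
  encode_row s = coord_field s ++ Semicolon :: encode_rat (prob s) ++
                 Semicolon :: utility_field s ++ [:: Semicolon].
Proof. by rewrite /encode_row /coord_field /utility_field -!map_comp. Qed.

Lemma notin_flatten (T : eqType) (x y : T) (bs : seq (seq T)) :
  x != y -> {in bs, forall b, x \notin b} ->
  x \notin flatten [seq b ++ [:: y] | b <- bs].
Proof.
move=> xy H; apply/flattenP => -[_ /mapP [b bbs ->]].
by rewrite mem_cat mem_seq1 (negbTE xy) (negbTE (H b bbs)).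
Qed.

Lemma semicolon_coord_field s : Semicolon \notin coord_field s.
Proof. by apply: notin_flatten => // _ /mapP [i _ ->]; apply: notin_encode_nat. Qed.

Lemma semicolon_utility_field s : Semicolon \notin utility_field s.
Proof. by apply: notin_flatten => // _ /mapP [i _ ->]; apply: encode_rat_notin. Qed.

Lemma split_problem (l : seq state) :
  split_at Semicolon [::] (flatten [seq encode_row s | s <- l]) =
  flatten [seq fields s | s <- l].
Proof.
elim: l => // s l IH; rewrite map_cons /= encode_row_fields -catA cat_cons -catA cat_cons -catA.
rewrite split_at_cat ?semicolon_coord_field // split_at_cat ?encode_rat_notin //.
by rewrite split_at_cat ?semicolon_utility_field // IH.
Qed.

Lemma group3_fields (l : seq state) :
  group3 (flatten [seq fields s | s <- l]) = [seq fields s | s <- l].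
Proof.
rewrite /group3; set G := foldr _ _ _; suff -> : G = ([::], [seq fields s | s <- l]) by [].
by rewrite {}/G; elim: l => //= s l ->.
Qed.

Lemma parse_encode w : Semicolon \notin w ->
  parse (w ++ Semicolon :: encode_problem D) = (to_bits w, rows).
Proof.
move=> Hw; rewrite /parse split_at_cat //= split_problem group3_fields.
by rewrite /rows -map_comp.
Qed.

Lemma row_coord s (i : 'I_(dim D)) : bval (nth [::] (row_of s).1 i) = enum_rank (s i).
Proof.
rewrite /row_of /parse_row /= /coord_field split_at_flatten; last first.
  by move=> _ /mapP [j _ ->]; apply: notin_encode_nat.
rewrite -map_comp (nth_map i) ?size_enum_ord // nth_ord_enum /=.
exact: to_bits_nat.
Qed.

Lemma size_row_coord s : size (row_of s).1 = dim D.
Proof.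
rewrite /row_of /parse_row /= /coord_field split_at_flatten; last first.
  by move=> _ /mapP [j _ ->]; apply: notin_encode_nat.
by rewrite 2!size_map size_enum_ord.
Qed.

Lemma row_utilities s :
  (row_of s).2.2 = [seq parse_frac (encode_rat (utility a s)) | a <- enum (action D)].
Proof.
rewrite /row_of /parse_row /= /utility_field split_at_flatten -?map_comp //.
by move=> _ /mapP [j _ ->]; apply: encode_rat_notin.
Qed.

Lemma row_utility s (a : action D) :
  nth zero_frac (row_of s).2.2 (enum_rank a) = parse_frac (encode_rat (utility a s)).
Proof. by rewrite row_utilities (nth_map a) -?cardE // nth_enum_rank. Qed.

Lemma row_prob s : (row_of s).2.1 = parse_frac (encode_rat (prob s)).
Proof. by []. Qed.

Definition mask_of I (m : bitstring) :=
  size m = dim D /\ forall i : 'I_(dim D), nth false m i = (i \in I).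

Lemma agree_restrict I m r s : mask_of I m ->
  agree m (row_of r) (row_of s) = (restrict I r == restrict I s).
Proof.
move=> [Hsz Hm]; apply/allP/eqP => [H | /ffunP E i].
  apply/ffunP => i; rewrite !ffunE; apply/enum_rank_inj/val_inj => /=.
  have /H : (val (val i) : nat) \in iota 0 (size m) by rewrite mem_iota Hsz /=.
  rewrite Hm (valP i) /= !leq_bitsE !row_coord => H2.
  by apply/eqP; rewrite eqn_leq.
rewrite mem_iota Hsz => /= lti; pose j := Ordinal lti.
have -> : i = j :> nat by [].
rewrite Hm !leq_bitsE !row_coord; case: (boolP (j \in I)) => //= jI.
by have := E (exist _ j jI); rewrite !ffunE /= => ->; rewrite leqnn.
Qed.

(** Positivity of the denominator is carried through the induction because [fval_add] and [fval_mul]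
    require it. *)
Lemma fold_fiber I m s (a : action D) (l : seq state) (acc : frac) : mask_of I m ->
  (0 < bval acc.2)%N ->
  let z := foldl (fun (acc : frac) (r : table_row) => if agree m r (row_of s)
                      then add_frac acc (mul_frac r.2.1 (nth zero_frac r.2.2 (enum_rank a)))
                      else acc) acc [seq row_of r | r <- l] in
  (0 < bval z.2)%N /\
  fval z = fval acc + \sum_(r <- l | restrict I r == restrict I s) prob r * utility a r.
Proof.
move=> Hm; elim: l acc => [|r l IH] acc Hacc; first by rewrite big_nil addr0.
rewrite big_cons map_cons; cbn [foldl]; rewrite (agree_restrict _ _ Hm).
case: eqP => _; last exact: IH.
have [Ep Hp] := parse_frac_encode (prob r).
have [Eu Hu] := parse_frac_encode (utility a r).
rewrite row_prob row_utility.
set y := mul_frac _ _.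
have Hy : (0 < bval y.2)%N by rewrite /= bval_mul muln_gt0 Hp.
have Hay : (0 < bval (add_frac acc y).2)%N by rewrite /= bval_mul muln_gt0 Hacc.
have [H1 H2] := IH _ Hay; split; first exact: H1.
by rewrite H2 fval_add // fval_mul // Ep Eu addrA.
Qed.

Lemma fiber_sumP I m s (a : action D) : mask_of I m ->
  (0 < bval (fiber_sum m rows (row_of s) (enum_rank a)).2)%N /\
  fval (fiber_sum m rows (row_of s) (enum_rank a)) =
    \sum_(r | restrict I r == restrict I s) prob r * utility a r.
Proof.
move=> Hm.
have [H1 H2] := fold_fiber s a (enum state) (acc := zero_frac) Hm isT.
by split; rewrite ?H2 // big_enum_cond /= /fval /= subrr mul0r add0r.
Qed.

(** The tests number the actions by their position in the table; [enum_rank] translates back. *)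
Lemma all_iota_enum (T : finType) (P : pred nat) :
  all P (iota 0 #|T|) = [forall a : T, P (enum_rank a)].
Proof.
apply/allP/forallP => [H a | H i]; first by apply: H; rewrite mem_iota /=.
rewrite mem_iota => /= lti.
by have := H (enum_val (Ordinal lti)); rewrite enum_valK.
Qed.

Lemma row_okP I m s : mask_of I m ->
  reflect (Opt_stoch (restrict I s) = Opt s) (row_ok m rows (row_of s)).
Proof.
move=> Hm.
have Hs : size (row_of s).2.2 = #|action D| by rewrite row_utilities size_map -cardE.
rewrite /row_ok Hs all_iota_enum.
have E1 (a : action D) : all (fun j => leq_frac (nth zero_frac (row_of s).2.2 j)
      (nth zero_frac (row_of s).2.2 (enum_rank a))) (iota 0 #|action D|) = (a \in Opt s).
  rewrite all_iota_enum inE; apply: eq_forallb => b; rewrite !row_utility.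
  have [Ea Ha] := parse_frac_encode (utility a s).
  have [Eb Hb] := parse_frac_encode (utility b s).
  by rewrite leq_fracE // Ea Eb.
have E2 (a : action D) : all (fun j => leq_frac (fiber_sum m rows (row_of s) j)
      (fiber_sum m rows (row_of s) (enum_rank a))) (iota 0 #|action D|) =
      (a \in Opt_stoch (restrict I s)).
  rewrite all_iota_enum inE; apply: eq_forallb => b.
  have [Ha Ea] := fiber_sumP s a Hm; have [Hb Eb] := fiber_sumP s b Hm.
  by rewrite leq_fracE // Ea Eb.
apply: (iffP forallP) => [H | E a].
  by apply/setP => a; have := H a; rewrite E1 E2 => /eqP ->.
by rewrite E1 E2 E.
Qed.

Lemma anchor_testP I m : mask_of I m ->
  reflect (has_stoch_anchor I) (anchor_test m rows).
Proof.
move=> Hm; rewrite /anchor_test; apply: (iffP hasP) => [[_ /mapP [s0 _ ->] /allP H] | [s0 H]].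
  exists s0 => s Es; apply/(row_okP _ Hm).
  have := H (row_of s) (map_f _ (mem_enum _ s)).
  by rewrite (agree_restrict _ _ Hm) Es eqxx.
exists (row_of s0); first by apply: map_f; rewrite mem_enum.
apply/allP => _ /mapP [s _ ->]; rewrite (agree_restrict _ _ Hm).
by case: eqP => //= Es; apply/(row_okP _ Hm)/H.
Qed.

Lemma mask_encode_subset I : mask_of I (to_bits (encode_subset I)).
Proof.
rewrite /to_bits /encode_subset -map_comp; split; first by rewrite size_map size_enum_ord.
move=> i; rewrite (nth_map i) ?size_enum_ord // nth_ord_enum /=.
by case: (i \in I).
Qed.

Definition support t : {set 'I_(dim D)} := [set i | enum_rank (t i) != 0 :> nat].

Lemma mask_support t : mask_of (support t) (nonzero_mask (row_of t)).
Proof.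
split; first by rewrite size_map size_row_coord.
move=> i; rewrite (nth_map [::]) ?size_row_coord // leq_bitsE row_coord inE leqn0 //.
Qed.

Lemma bval_weight m : bval (weight m) = count id m.
Proof.
have E acc : bval (foldl (fun acc (b : bool) => if b then add_bits acc [:: true] else acc)
    acc m) = (bval acc + count id m)%N.
  elim: m acc => [|b m IH] acc /=; first by rewrite addn0.
  by rewrite IH; case: b; rewrite ?bval_add /=; lia.
exact: E.
Qed.

Lemma weight_card I m : mask_of I m -> bval (weight m) = #|I|.
Proof.
move=> [Hsz Hm]; rewrite bval_weight -sum1_count (big_nth false) Hsz big_mkord sum1_card.
by apply: eq_card => i; rewrite -Hm.
Qed.

(** Sufficiency depends on the set only through the partition of the states into fibers. *)
Lemma stoch_sufficient_equiv I J :
  (forall r s, (restrict I r == restrict I s) = (restrict J r == restrict J s)) ->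
  stoch_sufficient I -> stoch_sufficient J.
Proof.
move=> E H s; rewrite -(H s); apply/setP => a; rewrite !inE; apply: eq_forallb => b.
by congr (_ <= _); apply: eq_bigl => r; rewrite E.
Qed.

(* The support leaves out only coordinates of [I] that have a single value, and these do
   not refine the fibers. *)
Lemma support_realizes I : exists t,
  support t \subset I /\
  forall r s, (restrict I r == restrict I s) = (restrict (support t) r == restrict (support t) s).
Proof.
(* A state exists because the probabilities sum to 1, while an empty sum is 0. *)
have [s0 _] : exists s0 : state, True.
  case: (pickP (@predT state)) => [s0 _ | H0]; first by exists s0.
  by have := prob_sum1 D; rewrite big_pred0 // => /eqP; rewrite eq_sym oner_eq0.
(* The value chosen has nonzero rank for [i] in [I] and rank 0 otherwise. The choice fails only for
   a single-valued coordinate of [I]; the default then has rank 0, and [i] drops out of the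
   support. *)
pose t : state := [ffun i => odflt (s0 i)
  [pick y | (enum_rank y != 0 :> nat) == (i \in I)]].
have tE i : (enum_rank (t i) != 0 :> nat) = (i \in I) \/
    i \in I /\ forall y : coord i, enum_rank y = 0 :> nat.
  rewrite ffunE; case: pickP => /= [y /eqP ->|H]; first by left.
  right; case: (boolP (i \in I)) H => iI H.
    by split=> // y; have := H y; rewrite eqb_id => /negbFE/eqP.
  (* Outside [I] the choice cannot fail: the set of values is nonempty, so rank 0 is attained. *)
  have lt0 : (0 < #|coord i|)%N by apply/card_gt0P; exists (s0 i).
  by have := H (enum_val (Ordinal lt0)); rewrite enum_valK.
exists t; split.
  apply/subsetP => i; rewrite inE; case: (tE i) => [-> //|[//]].
move=> r s; apply/eqP/eqP => /ffunP E; apply/ffunP => i; rewrite !ffunE.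
  have iI : val i \in I.
    by have := valP i; rewrite inE; case: (tE (val i)) => [-> //|[//]].
  by have := E (exist _ (val i) iI); rewrite !ffunE.
case: (tE (val i)) => [Ei | [_ H0]]; last first.
  by apply/enum_rank_inj/val_inj; rewrite /= !H0.
have it : val i \in support t by rewrite inE Ei (valP i).
by have := E (exist _ (val i) it); rewrite !ffunE.
Qed.

Lemma minimum_testP (k : bitstring) :
  reflect (exists I : {set 'I_(dim D)}, stoch_sufficient I /\ (#|I| <= bval k)%N)
          (minimum_test k rows).
Proof.
have sufP t : reflect (stoch_sufficient (support t))
    (all (row_ok (nonzero_mask (row_of t)) rows) rows).
  apply: (iffP allP) => [H s | H _ /mapP [s _ ->]].
    by apply/(row_okP _ (mask_support t))/H/map_f; rewrite mem_enum.
  by apply/(row_okP _ (mask_support t)).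
have cardP t : leq_bits (weight (nonzero_mask (row_of t))) k = (#|support t| <= bval k)%N.
  by rewrite leq_bitsE (weight_card (mask_support t)).
apply: (iffP hasP) => [[_ /mapP [t _ ->]] | [I [HI Ik]]].
  by rewrite cardP => /andP [tk /sufP Ht]; exists (support t).
(* A sufficient [I] is traded for the support of some state, which has the same fibers and no more
   elements. *)
have [t [tI E]] := support_realizes I.
exists (row_of t); first by apply: map_f; rewrite mem_enum.
rewrite cardP (leq_trans (subset_leq_card tI) Ik) /=.
by apply/sufP; apply: stoch_sufficient_equiv HI.
Qed.

End Problem.

Theorem mainTheorem6 :
  polytime_decidable stoch_minimum_preservation /\
  polytime_decidable stoch_anchor_preservation.
Proof.
split.
- apply: (@polytime_decides _ (fun w => minimum_test (parse w).1 (parse w).2)).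
    apply: polytime_minimum_test; first exact: polytime_fst polytime_parse.
    exact: polytime_snd polytime_parse.
  move=> [D k]; apply: iff_sym.
  have := parse_encode D (notin_encode_nat k (isT : ~~ is_digit Semicolon)).
  rewrite -[encode_nat k ++ _]/(@encode _ stoch_minimum_preservation (D, k)) => ->.
  by have := rwP (minimum_testP D (to_bits (encode_nat k))); rewrite to_bits_nat.
- apply: (@polytime_decides _ (fun w => anchor_test (parse w).1 (parse w).2)).
    apply: polytime_anchor_test; first exact: polytime_fst polytime_parse.
    exact: polytime_snd polytime_parse.
  move=> [D I]; apply: iff_sym.
  (* An encoded subset consists of bits only, so the first semicolon ends the header. *)
  have HI : Semicolon \notin encode_subset I by apply/mapP => -[].
  have := parse_encode D HI.
  rewrite -[encode_subset I ++ _]/(@encode _ stoch_anchor_preservation (existT _ D I)) => ->.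
  exact: (rwP (anchor_testP (mask_encode_subset I))).
Qed.
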